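(* Assume $f$ is $\mu$-strongly convex (with respect to $\|\cdot\|$) and $L$-smooth relative to $h$, with minimizer $x^*$ over $\mathcal X$, and assume $\sigma>0$. For $\delta>0$ let $$\tau_\delta=\inf\{t=1,2,\dots:\|x_t-x^*\|\le\delta\}.$$ Then there is $\delta_0>0$ (depending on the problem data but not on $\delta$ or $\eta$) such that for every $\delta\in(0,\delta_0]$: if (SDA) is run with $y_1=0$ and constant learning rate $\eta$ with $0<\eta<[\mu p\delta^2/(2V_\sigma^p)]^{1/(p-1)}$, then $$\mathbb E[\tau_\delta]\le\frac2\mu\,\frac{H/\eta+f(x_1)-\min f+\mu\delta^2/2}{\delta^2-\delta_\eta^2},\qquad \delta_\eta^2=\frac{2}{\mu p}\eta^{p-1}V_\sigma^p.$$ In particular, if (SDA) is run with $\eta=[\mu\delta^2/(2V_\sigma^p)]^{1/(p-1)}$, then $$\mathbb E[\tau_\delta]\le\frac{p}{p-1}\left[1+\frac{2[f(x_1)-\min f]}{\mu\delta^2}+H\left(\frac{2V_\sigma}{\mu\delta^2}\right)^{\frac{p}{p-1}}\right]=\mathcal O\left(\frac1{\delta^{2p/(p-1)}}\right).$$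
   Context: Optimization setup. $\mathcal V$ is a real $n$-dimensional normed space with norm $\|\cdot\|$; $\mathcal Y=\mathcal V^*$ is its dual, with pairing $\langle y,x\rangle$ and dual norm $\|y\|_*=\sup\{\langle y,x\rangle:\|x\|\le1\}$. $\mathcal X\subset\mathcal V$ is a nonempty compact convex set with diameter $\|\mathcal X\|=\max_{x,x'\in\mathcal X}\|x'-x\|$. The objective $f:\mathcal V\to\mathbb R\cup\{\infty\}$ is convex, finite and continuous on $\mathcal X$, and $\partial f$ admits a continuous selection $\nabla f(x)\in\partial f(x)$ on $\operatorname{dom}\partial f=\{x:\partial f(x)\ne\varnothing\}$. $\min f$ is taken over $\mathcal X$. $f$ is $\mu$-strongly convex ($\mu>0$) if $f(x')\ge f(x)+\langle\nabla f(x),x'-x\rangle+\frac\mu2\|x'-x\|^2$ for all $x,x'\in\mathcal X$ (with $\nabla f(x)$ defined). Mirror setup. $h:\mathcal V\to\mathbb R\cup\{\infty\}$ is convex with $\operatorname{dom}h=\mathcal X$, continuous on $\mathcal X$; $\mathcal X_h=\operatorname{dom}\partial h$; $\partial h$ admits a continuous selection $\nabla h$ on $\mathcal X_h$; and for some $K>0$, $h(x')\ge h(x)+\langle\nabla h(x),x'-x\rangle+\frac K2\|x'-x\|^2$ for all $x\in\mathcal X_h$, $x'\in\mathcal X$. It is assumed that $\nabla f$ is defined on $\mathcal X_h$. $D(x',x)=h(x')-h(x)-\langle\nabla h(x),x'-x\rangle$ is the Bregman divergence, $Q(y)=\operatorname{argmax}_{x\in\mathcal X}\{\langle y,x\rangle-h(x)\}$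 the mirror map, and $H=\max_{\mathcal X}h-\min_{\mathcal X}h$. $f$ is $L$-smooth relative to $h$ if $f(x')\le f(x)+\langle\nabla f(x),x'-x\rangle+L\,D(x',x)$ for all $x\in\mathcal X_h$, $x'\in\mathcal X$. Algorithm. (SDA): $y_{t+1}=y_t-g_t$, $x_{t+1}=Q(\eta_{t+1}y_{t+1})$, $t=1,2,\dots$, with $x_1=Q(\eta_1y_1)$ and stochastic gradients $g_t=\nabla f(x_t)+U_t$, $U_t=U(x_t;\omega_t)$, where $\omega_1,\omega_2,\dots$ are i.i.d. random seeds and, for all $x\in\operatorname{dom}\partial f$, $\mathbb E[U(x;\omega)]=0$ and $\mathbb E[\|U(x;\omega)\|_*^p]\le\sigma^p$ for some $p\in(1,2]$. Noise constant: $V_\sigma^p=\|\mathcal X\|^{2-p}(2/K)^{p-1}\sigma^p$. *)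

(* Defs.v *)
From HB Require Import structures.
From mathcomp Require Import all_boot all_order all_algebra.
From mathcomp Require Import all_classical all_reals all_analysis.

Set Implicit Arguments.
Unset Strict Implicit.
Unset Printing Implicit Defensive.

Import Order.TTheory GRing.Theory Num.Theory.
Import numFieldNormedType.Exports.

Local Open Scope classical_set_scope.
Local Open Scope ring_scope.

(* Finite-dimensional real normed spaces; the library has both parents but not
   their join. *)
#[short(type="normedVectType")]
HB.structure Definition NormedVector (R : realType) :=
  {V of NormedModule R V & Vector R V}.

(* In finite dimension every linear form is continuous, so the topological dual
   is the space of all linear forms. *)
Notation dual V := 'Hom(V, _^o).

Definition pairing (R : realType) (V : normedVectType R)
    (y : dual V) (v : V) : R := y v.

Definition dual_norm (R : realType) (V : normedVectType R) (y : dual V) : R :=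
  sup [set pairing y v | v in [set v | `|v| <= 1]].

(* The maxima and minima over the compact set X (of continuous functions) are
   attained; they are written as suprema and infima. *)
Definition diam (R : realType) (V : normedVectType R) (X : set V) : R :=
  sup [set `|x' - x| | x in X & x' in X].

Definition min_on (R : realType) (V : normedVectType R) (X : set V)
    (f : V -> \bar R) : R := fine (ereal_inf (f @` X)).

Definition max_on (R : realType) (V : normedVectType R) (X : set V)
    (f : V -> \bar R) : R := fine (ereal_sup (f @` X)).

Definition is_minimizer (R : realType) (V : normedVectType R) (X : set V)
    (f : V -> \bar R) (xs : V) : Prop :=
  X xs /\ forall x, X x -> (f xs <= f x)%E.

(* Convexity of a function with values in R `|` {+oo}.  As 0 < a < 1 and f
   avoids -oo, the right-hand side is never of the form 0 * oo or oo - oo. *)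
Definition convex_efun (R : realType) (V : normedVectType R)
    (f : V -> \bar R) : Prop :=
  (forall x, f x != -oo%E) /\
  (forall (x x' : V) (a : R), 0 < a < 1 ->
     (f (a *: x + (1 - a) *: x')%R <= a%:E * f x + (1 - a)%:E * f x')%E).

Definition eff_dom (R : realType) (V : normedVectType R)
    (f : V -> \bar R) : set V := [set x | (f x < +oo)%E].

Definition subdiff (R : realType) (V : normedVectType R) (f : V -> \bar R)
    (x : V) : set (dual V) :=
  [set y | forall x', (f x + (pairing y (x' - x))%:E <= f x')%E].

Definition dom_subdiff (R : realType) (V : normedVectType R)
    (f : V -> \bar R) : set V := [set x | subdiff f x !=set0].

(* gradf is only meaningful on dom_subdiff f; continuity is that of the
   restriction to dom_subdiff f, for the dual norm. *)
Definition continuous_selection (R : realType) (V : normedVectType R)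
    (f : V -> \bar R) (gradf : V -> dual V) : Prop :=
  (forall x, dom_subdiff f x -> subdiff f x (gradf x)) /\
  (forall x, dom_subdiff f x ->
     dual_norm (gradf z - gradf x)
       @[z --> within (dom_subdiff f) (nbhs x)] --> (0 : R)).

(* f is mu-strongly convex with base points x in D and test points x' in X. *)
Definition strongly_convex (R : realType) (V : normedVectType R) (D X : set V)
    (f : V -> \bar R) (gradf : V -> dual V) (mu : R) : Prop :=
  forall x x', D x -> X x' ->
    (f x + (pairing (gradf x) (x' - x) + mu / 2 * `|x' - x| ^+ 2)%:E
       <= f x')%E.

Definition bregman (R : realType) (V : normedVectType R) (h : V -> \bar R)
    (gradh : V -> dual V) (x' x : V) : \bar R :=
  (h x' - h x - (pairing (gradh x) (x' - x))%:E)%E.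

Definition relatively_smooth (R : realType) (V : normedVectType R) (X : set V)
    (f : V -> \bar R) (gradf : V -> dual V)
    (h : V -> \bar R) (gradh : V -> dual V) (L : R) : Prop :=
  forall x x', dom_subdiff h x -> X x' ->
    (f x' <= f x + (pairing (gradf x) (x' - x))%:E
             + L%:E * bregman h gradh x' x)%E.

(* argmax over x in X of <y, x> - h x; for the strongly convex h considered
   here the argmax is a singleton, and xget picks its element. *)
Definition mirror_map (R : realType) (V : normedVectType R) (X : set V)
    (h : V -> \bar R) (y : dual V) : V :=
  xget 0 [set x | X x /\
    forall x', X x' -> ((pairing y x')%:E - h x' <= (pairing y x)%:E - h x)%E].

Definition borel (R : realType) (V : normedVectType R) :=
  g_sigma_algebraType (@open V).

(* (x, s) |-> U x s is jointly measurable; the Borel sets of the (finite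
   dimensional) dual are generated by the evaluations at the vectors of V.  U is total: its values at
   points x where the gradient is undefined play no role, and a jointly
   measurable map on such a subdomain extends to a total one. *)
Definition jointly_measurable (R : realType) (V : normedVectType R)
    d (T : measurableType d) (U : V -> T -> dual V) : Prop :=
  forall v : V, measurable_fun [set: borel V * T]
    (fun z : borel V * T => pairing (U z.1 z.2) v).

Definition iid (R : realType) d (Omega : measurableType d)
    (P : probability Omega R) d' (T : measurableType d')
    (xi : nat -> {RV P >-> T}) : Prop :=
  (forall (I : seq nat) (A : nat -> set T), uniq I ->
     (forall t, measurable (A t)) ->
     P (\bigcap_(t in [set` I]) (xi t @^-1` A t)) =
     (\prod_(t <- I) P (xi t @^-1` A t))%E) /\
  (forall (t : nat) (A : set T), measurable A ->
     distribution P (xi t) A = distribution P (xi 0%N) A).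

(* For all x in D: E[U(x; xi)] = 0 and E[|U(x; xi)|_*^p] <= sigma^p.  The
   expectation of a dual vector is taken against each vector of V. *)
Definition unbiased_bounded_noise (R : realType) (V : normedVectType R)
    d (Omega : measurableType d) (P : probability Omega R)
    d' (T : measurableType d') (D : set V) (U : V -> T -> dual V)
    (xi : {RV P >-> T}) (sigma p : R) : Prop :=
  forall x, D x ->
    (forall v : V, ('E_P[(fun w => pairing (U x (xi w)) v)] = 0)%E) /\
    (\int[P]_w ((dual_norm (U x (xi w))) `^ p)%:E <= (sigma `^ p)%:E)%E.

(* The p-th root of |X|^(2-p) (2/K)^(p-1) sigma^p. *)
Definition noise_const (R : realType) (V : normedVectType R) (X : set V)
    (K sigma p : R) : R :=
  (diam X `^ (2 - p) * (2 / K) `^ (p - 1) * sigma `^ p) `^ p^-1.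

(* Stochastic dual averaging, with iterates and seeds indexed by t = 1, 2, ... ;
   the values at index 0 are irrelevant. *)
Definition SDA (R : realType) (V : normedVectType R) (X : set V)
    (gradf : V -> dual V) (h : V -> \bar R)
    (Omega T : Type) (U : V -> T -> dual V) (xi : nat -> Omega -> T)
    (eta : nat -> R) (y1 : dual V)
    (y : nat -> Omega -> dual V) (x : nat -> Omega -> V) : Prop :=
  forall w, y 1%N w = y1 /\
    forall t, (0 < t)%N ->
      x t w = mirror_map X h (eta t *: y t w) /\
      y t.+1 w = y t w - (gradf (x t w) + U (x t w) (xi t w)).

(* The first t >= 1 with |x_t - xs| <= delta, and +oo if there is none. *)
Definition hitting_time (R : realType) (V : normedVectType R) (Omega : Type)
    (x : nat -> Omega -> V) (xs : V) (delta : R) (w : Omega) : \bar R :=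
  ereal_inf [set t%:R%:E | t in
    [set t : nat | (0 < t)%N /\ `|x t w - xs| <= delta]].

(* Main.v *)
Require Import Defs.
From HB Require Import structures.
From mathcomp Require Import all_boot all_order all_algebra.
From mathcomp Require Import all_classical all_reals all_analysis.
From mathcomp Require Import measurable_realfun.
From mathcomp Require Import ring lra.

Set Implicit Arguments.
Unset Strict Implicit.
Unset Printing Implicit Defensive.

Import Order.TTheory GRing.Theory Num.Theory.
Import numFieldNormedType.Exports.

Local Open Scope classical_set_scope.
Local Open Scope ring_scope.
Import VectorInternalTheory.

(* Write x = Q(eta y) for the iterate of the dual state y.  The energy
     E(y) = h(xs) - h(x) - <eta y, xs - x> + eta (f(x) - f(xs)) >= 0
   decreases in mean by at least eta mu/2 (delta^2 - delta_eta^2) per step as long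
   as |x - xs| > delta: strong convexity of f gives eta mu/2 |x - xs|^2, relative
   smoothness turns the drift at x into the gap f - f(xs) at the next iterate at
   the price of eta L D, and what is left of the Bregman divergence absorbs the
   noise by Young's inequality, at a cost of eta^p Vs^p / p.  Summing the drift up
   to the hitting time (Foster-Lyapunov) bounds its mean by 1 + E(0) divided by
   the drift, and E(0) <= H + eta (f(x_1) - min f).  delta_0 only ensures
   eta L <= 1/p. *)

(** * Young's inequality *)

(** Strong convexity of [h] and relative smoothness are stated with the selection [gradh x], while
    the algorithm supplies [eta *: y], a possibly different subgradient at the same [x]: normal
    directions to [X] can be added. Continuity of the selection gives [pairing y (x' - x) <= pairing
    (gradh x) (x' - x)] for [x'] in [X], which is the direction needed; the energy is written with
    [eta *: y], whose pairings change linearly with the update of [y]. The Bregman divergence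
    between consecutive iterates is split into a share 1/p for smoothness and a share 1 - 1/p for
    Young's inequality, whence the condition eta L <= 1/p. Much of the remaining work is
    measurability: the state lives in the dual, [gradf] is controlled only on its domain, and the
    mirror map is defined by choice and gets its regularity from strong convexity. *)

Section real_powers.
Context {R : realType}.

(* With w = 2 a / (K r) this is Young's inequality w <= 1 - 1/p + w^p / p; the
   bound r <= D is only used to replace r^(2-p) by D^(2-p). *)
Lemma young_descent (a r D K p : R) : 0 <= a -> 0 <= r -> r <= D -> 0 < K ->
  1 < p -> p <= 2 ->
  a * r <= (1 - p^-1) * (K / 2) * r ^+ 2
           + p^-1 * (D `^ (2 - p) * (2 / K) `^ (p - 1) * a `^ p).
Proof.
move=> a0; rewrite le_eqVlt => /orP[/eqP <- _ K0 p1 p2|r0 rD K0 p1 p2].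
  rewrite expr0n/= !mulr0 add0r !mulr_ge0 ?powR_ge0// invr_ge0; lra.
have p0 : 0 < p by lra.
pose b := K / 2 * r; have b0 : 0 < b by rewrite mulr_gt0// divr_gt0.
pose w := a / b; have w0 : 0 <= w by rewrite divr_ge0// ltW.
have aE : a = w * b by rewrite /w divfK// gt_eqF.
have young : w <= 1 - p^-1 + w `^ p / p.
  have q0 : 0 < (1 - p^-1)^-1 by rewrite invr_gt0 subr_gt0 invf_lt1.
  have := @conjugate_powR R w 1 p (1 - p^-1)^-1 w0 ler01 p0 q0.
  by rewrite invrK subrKC mulr1 powR1 mul1r addrC; exact.
apply: (@le_trans _ _ ((1 - p^-1) * (K / 2) * r ^+ 2
    + p^-1 * (r `^ (2 - p) * (2 / K) `^ (p - 1) * a `^ p))); last first.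
  rewrite lerD2l ler_wpM2l ?invr_ge0 ?(ltW p0)// -!mulrA ler_wpM2r//.
    by rewrite mulr_ge0// powR_ge0.
  by apply: ge0_ler_powR; rewrite ?nnegrE; lra.
have -> : r `^ (2 - p) * (2 / K) `^ (p - 1) * a `^ p
    = w `^ p * (K / 2 * r ^+ 2).
  have K2 : 0 < K / 2 by lra.
  rewrite aE powRM ?(ltW b0)// /b powRM ?(ltW K2) ?(ltW r0)//.
  have -> : 2 / K = (K / 2)^-1 by rewrite invf_div.
  rewrite -powR_inv1 ?(ltW K2)// -powRrM.
  have -> : r ^+ 2 = r `^ (2 - p) * r `^ p.
    rewrite -powRD ?(gt_eqF r0) ?implybT// subrK.
    by rewrite powR_mulrn// ltW.
  have -> : (K / 2) `^ p = (K / 2) `^ (p - 1) * (K / 2).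
    by rewrite [RHS]mulrC mulr_powRB1// ltW.
  have : (K / 2) `^ (-1 * (p - 1)) * (K / 2) `^ (p - 1) = 1.
    rewrite -powRD ?(gt_eqF K2) ?implybT//.
    by rewrite mulN1r addNr powRr0.
  set A := _ `^ (-1 * _); set B := _ `^ (p - 1) => AB.
  transitivity (A * B * (w `^ p * (K / 2) * r `^ p * r `^ (2 - p))); first ring.
  by rewrite AB; ring.
rewrite aE /b.
have : w * (K / 2 * r ^+ 2) <= (1 - p^-1 + w `^ p / p) * (K / 2 * r ^+ 2).
  by rewrite ler_wpM2r// mulr_ge0 ?sqr_ge0//; lra.
by lra.
Qed.

End real_powers.

(** * Duality in finite dimension *)

Section finite_dimension.
Context {R : realType} {V : normedVectType R}.
Implicit Types (v : V) (y : dual V).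

Let n := dim V.
Definition vbase (i : 'I_n) : V := @r2v R V (delta_mx 0 i).

Lemma vbase_sum v : v = \sum_i v2r v 0 i *: vbase i.
Proof.
rewrite -{1}[v]v2rK [in LHS](matrix_sum_delta (v2r v)) big_ord1.
by rewrite linear_sum; apply: eq_bigr => i _; rewrite linearZ.
Qed.

Lemma pairing_sum y v : pairing y v = \sum_i v2r v 0 i * pairing y (vbase i).
Proof.
rewrite /pairing {1}(vbase_sum v) linear_sum.
by apply: eq_bigr => i _; rewrite linearZ.
Qed.

Lemma ler_rV_norm (a : 'rV[R]_n) i : `|a 0 i| <= `|a|.
Proof.
rewrite [leRHS]/Num.norm /= mx_normrE.
exact: (le_bigmax _ (fun ij : 'I_1 * 'I_n => `|a ij.1 ij.2|) (0, i)).
Qed.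

Lemma norm_r2v_le :
  exists2 C : R, 0 < C & forall a : 'rV[R]_n, `|@r2v R V a| <= C * `|a|.
Proof.
exists (1 + \sum_i `|vbase i|).
  by rewrite ltr_pwDl// sumr_ge0.
move=> a; rewrite (vbase_sum (@r2v R V a)) r2vK.
apply: (le_trans (ler_norm_sum _ _ _)).
apply: (@le_trans _ _ (\sum_i `|a| * `|vbase i|)).
  by apply: ler_sum => i _; rewrite normrZ ler_wpM2r// ler_rV_norm.
by rewrite -mulr_sumr mulrC ler_wpM2r// lerDr.
Qed.

Lemma continuous_norm_r2v : continuous (fun a : 'rV[R]_n => `|@r2v R V a|).
Proof.
have [C C0 HC] := norm_r2v_le.
move=> a; apply/(@cvgrPdist_lt _ _ _ (nbhs a)) => e e0.
apply/nbhs_ballP; exists (e / C) => /=; first by rewrite divr_gt0.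
move=> b; rewrite mx_norm_ball /ball_/= => ab.
apply: (le_lt_trans (ler_dist_dist _ _)).
rewrite -linearB/=; apply: (le_lt_trans (HC _)).
by rewrite mulrC -ltr_pdivlMr.
Qed.

(** Equivalence of norms: the norm of [V] is continuous in the coordinates, so it has a positive
    minimum on the compact unit sphere of the sup norm; [C] is the inverse of that minimum. *)
Lemma coord_bound :
  exists2 C : R, 0 < C & forall v i, `|v2r v 0 i| <= C * `|v|.
Proof.
pose S := [set a : 'rV[R]_n | `|a| = 1].
have cS : compact S.
  apply: bounded_closed_compact.
    exists 1; split; first exact: num_real.
    by move=> M M1 a /= ->; exact: ltW.
  have -> : S = (fun a : 'rV[R]_n => `|a|) @^-1` [set 1] by [].
  apply: closed_comp; first by move=> x _; exact: norm_continuous.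
  exact/accessible_closed_set1/hausdorff_accessible/Rhausdorff.
(* The sphere is empty only in dimension zero, where every coordinate vector vanishes. *)
have [[a0 Sa0]|S0] := pselect (S !=set0); last first.
  exists 1 => // v i; suff -> : v2r v = 0 by rewrite mxE normr0 mul1r.
  apply/eqP; apply/negP => /negP v0.
  apply: S0; exists (`|v2r v|^-1 *: v2r v).
  by rewrite /S/= normrZ normfV normr_id mulVf// normr_eq0.
have cN : {within S, continuous (fun a : 'rV[R]_n => `|@r2v R V a|)}.
  exact/continuous_subspaceT/continuous_norm_r2v.
have [c /set_mem Sc Hc] := compact_EVT_min (ex_intro _ a0 Sa0) cS cN.
have m0 : 0 < `|@r2v R V c|.
  rewrite normr_gt0; apply/eqP => /(congr1 v2r); rewrite r2vK linear0 => c0.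
  by move: Sc; rewrite /S/= c0 normr0 => /esym/eqP; rewrite oner_eq0.
exists (`|@r2v R V c|^-1); first by rewrite invr_gt0.
move=> v i; rewrite mulrC ler_pdivlMr//.
apply: (@le_trans _ _ (`|v2r v| * `|@r2v R V c|)).
  by rewrite ler_wpM2r// ler_rV_norm.
have [v0|v0] := eqVneq `|v2r v| 0; first by rewrite v0 mul0r.
have vgt0 : 0 < `|v2r v| by rewrite lt_neqAle eq_sym v0 normr_ge0.
rewrite mulrC -ler_pdivlMr//.
have := Hc (`|v2r v|^-1 *: v2r v).
rewrite inE /S/= normrZ normfV normr_id mulVf// => /(_ erefl) /le_trans; apply.
by rewrite linearZ/= normrZ normfV normr_id v2rK mulrC.
Qed.

Lemma pairing_bound :
  exists2 C : R, 0 < C & forall y v,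
    `|pairing y v| <= C * (\sum_i `|pairing y (vbase i)|) * `|v|.
Proof.
have [C C0 HC] := coord_bound; exists C => // y v.
rewrite pairing_sum mulrAC mulr_sumr.
apply: (le_trans (ler_norm_sum _ _ _)); apply: ler_sum => i _.
by rewrite normrM ler_wpM2r.
Qed.

Lemma pairingB y y' v : pairing (y - y') v = pairing y v - pairing y' v.
Proof. by rewrite /pairing lfunE/= lfunE. Qed.

Lemma pairingD y y' v : pairing (y + y') v = pairing y v + pairing y' v.
Proof. by rewrite /pairing lfunE. Qed.

Lemma pairingZ c y v : pairing (c *: y) v = c * pairing y v.
Proof. by rewrite /pairing lfunE. Qed.

Lemma pairingBr y v v' : pairing y (v - v') = pairing y v - pairing y v'.
Proof. by rewrite /pairing linearB. Qed.

Lemma pairingDr y v v' : pairing y (v + v') = pairing y v + pairing y v'.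
Proof. by rewrite /pairing linearD. Qed.

Lemma pairingZr c y v : pairing y (c *: v) = c * pairing y v.
Proof. by rewrite /pairing linearZ. Qed.

Lemma pairingNr y v : pairing y (- v) = - pairing y v.
Proof. by rewrite /pairing linearN. Qed.

(** Boundedness gives [dual_norm] its meaning: [sup] of an unbounded set is a default value. *)
Lemma dual_norm_has_sup y : has_sup [set pairing y v | v in [set v | `|v| <= 1]].
Proof.
split; first by exists (pairing y 0), 0 => //=; rewrite normr0.
have [C C0 HC] := pairing_bound.
exists (C * (\sum_i `|pairing y (vbase i)|)) => _ [v /= v1 <-].
apply: (le_trans (ler_norm _)); apply: (le_trans (HC y v)).
by rewrite ler_piMr// mulr_ge0 ?sumr_ge0// ltW.
Qed.

Lemma dual_norm_ub y v : `|v| <= 1 -> pairing y v <= dual_norm y.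
Proof.
by move=> v1; apply: (sup_upper_bound (dual_norm_has_sup y)); exists v.
Qed.

Lemma dual_norm_le y M : (forall v, `|v| <= 1 -> pairing y v <= M) ->
  dual_norm y <= M.
Proof.
move=> yM; apply: ge_sup; first by case: (dual_norm_has_sup y).
by move=> _ [v /= v1 <-]; exact: yM.
Qed.

Lemma dual_norm_ge0 y : 0 <= dual_norm y.
Proof.
by rewrite -[leLHS](linear0 y); apply: dual_norm_ub; rewrite normr0.
Qed.

Lemma pairing_le y v : pairing y v <= dual_norm y * `|v|.
Proof.
have [->|v0] := eqVneq v 0; first by rewrite normr0 mulr0 /pairing linear0.
have vgt0 : 0 < `|v| by rewrite normr_gt0.
rewrite -ler_pdivrMr// mulrC -pairingZr; apply: dual_norm_ub.
by rewrite normrZ normfV normr_id mulVf// gt_eqF.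
Qed.

Lemma normr_pairing_le y v : `|pairing y v| <= dual_norm y * `|v|.
Proof. by rewrite ler_norml pairing_le lerNl -pairingNr -(normrN v) pairing_le. Qed.

Lemma dual_normD y y' : dual_norm (y + y') <= dual_norm y + dual_norm y'.
Proof.
by apply: dual_norm_le => v v1; rewrite pairingD lerD// dual_norm_ub.
Qed.

Lemma dual_norm_coord :
  exists2 C : R, 0 < C & forall y, dual_norm y <= C * \sum_i `|pairing y (vbase i)|.
Proof.
have [C C0 HC] := pairing_bound; exists C => // y; apply: dual_norm_le => v v1.
apply: (le_trans (ler_norm _)); apply: (le_trans (HC y v)).
by rewrite ler_piMr// mulr_ge0 ?sumr_ge0// ltW.
Qed.

End finite_dimension.

(** * The mirror map and the energy *)

Section mirror.
Context {R : realType} {V : normedVectType R}.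
Implicit Types (v : V) (y : dual V).

Lemma lipschitz_continuous (g : V -> R) (C : R) : 0 < C ->
  (forall v w, `|g v - g w| <= C * `|v - w|) -> continuous g.
Proof.
move=> C0 gC a; apply/cvgrPdist_lt => e e0.
apply/nbhs_ballP; exists (e / C) => /=; first by rewrite divr_gt0.
move=> b; rewrite -ball_normE /ball_/= => ab.
by apply: (le_lt_trans (gC _ _)); rewrite mulrC -ltr_pdivlMr.
Qed.

Lemma within_continuous_fine (A : set V) (g : V -> \bar R) :
  (forall x, A x -> g x \is a fin_num) -> {within A, continuous g} ->
  {within A, continuous (fine \o g)}.
Proof.
move=> gfin; rewrite continuous_subspace_in => gc.
rewrite continuous_subspace_in => x Ax.
apply: fine_cvg; rewrite fineK; last exact: gfin (set_mem Ax).
exact: gc.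
Qed.

Lemma continuous_coord i : continuous (fun v : V => v2r v 0 i).
Proof.
have [C C0 HC] := @coord_bound R V.
apply: (lipschitz_continuous C0) => v w.
by apply: le_trans (HC _ i); rewrite linearB !mxE.
Qed.

Lemma linear_pairing (g : V -> R) :
  (forall c v w, g (c *: v + w) = c * g v + g w) ->
  exists y, forall v, pairing y v = g v.
Proof.
move=> gl.
pose glin := GRing.isLinear.Build R V R^o _ (g : V -> R^o) gl.
pose gL : {linear V -> R^o} := HB.pack (g : V -> R^o) glin.
by exists (linfun gL) => v; rewrite /pairing lfunE.
Qed.

(** A limit as [s] tends to 0, done by hand: if [a] were negative, the [s] chosen below would make
    [a + s * b] negative. *)
Lemma ge0_of_affine_ge0 (a b : R) :
  (forall s, 0 < s < 1 -> 0 <= a + s * b) -> 0 <= a.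
Proof.
move=> ab; rewrite leNgt; apply/negP => a0.
pose s : R := - a / (- a + `|b| + 1).
have den : 0 < - a + `|b| + 1 by have := normr_ge0 b; lra.
have /ab : 0 < s < 1.
  rewrite divr_gt0//; last by lra.
  by rewrite ltr_pdivrMr// mul1r; have := normr_ge0 b; lra.
apply/negP; rewrite -ltNge.
have : s * b <= s * `|b| by rewrite ler_wpM2l ?ler_norm// divr_ge0 ?ltW//; lra.
have : s * `|b| < - a; last by lra.
rewrite /s mulrAC ltr_pdivrMr// ltr_pM2l; last by lra.
by lra.
Qed.

Lemma continuous_selection_dist (g : V -> \bar R) (gradg : V -> dual V) x (e : R) :
  continuous_selection g gradg -> dom_subdiff g x -> 0 < e ->
  exists2 r : R, 0 < r & forall z, dom_subdiff g z -> `|z - x| < r ->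
    dual_norm (gradg z - gradg x) < e.
Proof.
move=> [_ gc] Dx e0.
have /cvgrPdist_lt/(_ e e0) := gc x Dx.
rewrite near_withinE => /nbhs_ballP[r /= r0 Hr].
exists r => // z Dz zx.
have : ball x r z by rewrite -ball_normE /ball_/= distrC.
by move/Hr/(_ Dz); rewrite /= sub0r normrN ger0_norm// dual_norm_ge0.
Qed.

Context {X : set V} {h : V -> \bar R} {gradh : V -> dual V} {K : R}.
Context (X_nonempty : X !=set0) (X_compact : compact X)
  (h_convex : convex_efun h) (h_dom : eff_dom h = X)
  (h_continuous : {within X, continuous h})
  (h_selection : continuous_selection h gradh) (K_gt0 : 0 < K)
  (h_strongly_convex : strongly_convex (dom_subdiff h) X h gradh K).

Let hr x := fine (h x).

Lemma h_fin x : X x -> h x = (hr x)%:E.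
Proof.
move=> Xx; rewrite fineK// fin_numE h_convex.1/=.
by move: Xx; rewrite -h_dom /eff_dom/= => /lt_eqF ->.
Qed.

Lemma h_pinfty x : ~ X x -> h x = +oo%E.
Proof.
rewrite -h_dom /eff_dom/= => /negP; by rewrite -leNgt leye_eq => /eqP.
Qed.

(** Off [X] the value of [h] is [+oo], so the subgradient inequality is vacuous there; it also
    forces [x] into [X], because [h] is finite somewhere. *)
Lemma subdiffP x y : subdiff h x y <->
  X x /\ forall x', X x' -> hr x + pairing y (x' - x) <= hr x'.
Proof.
split=> [xy|[Xx xy] x'].
  have Xx : X x.
    apply: contrapT => nXx; have [x0 Xx0] := X_nonempty.
    by have := xy x0; rewrite h_pinfty// (h_fin Xx0).
  by split=> // x' Xx'; have := xy x'; rewrite !h_fin// lee_fin.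
have [Xx'|nXx'] := pselect (X x').
  by rewrite !h_fin// lee_fin; exact: xy.
by rewrite (h_pinfty nXx') leey.
Qed.

Lemma dom_subdiff_sub : dom_subdiff h `<=` X.
Proof. by move=> x [y /subdiffP[]]. Qed.

Lemma hr_convex x x' s : X x -> X x' -> 0 < s < 1 ->
  X (s *: x' + (1 - s) *: x) /\
  hr (s *: x' + (1 - s) *: x) <= s * hr x' + (1 - s) * hr x.
Proof.
move=> Xx Xx' s01; have := h_convex.2 x' x s s01.
rewrite (h_fin Xx) (h_fin Xx') => hc.
have Xs : X (s *: x' + (1 - s) *: x).
  by rewrite -h_dom /eff_dom/=; apply: (le_lt_trans hc); rewrite ltry.
by split=> //; move: hc; rewrite (h_fin Xs) -!EFinM -EFinD lee_fin.
Qed.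

Lemma hr_continuous : {within X, continuous hr}.
Proof. by apply: within_continuous_fine => // x /h_fin ->. Qed.
(* The minimizer over X of h plus a large multiple of the squared coordinate
   distance to a is close to a, and by the first order condition the gradient
   of the smooth penalty gives a subgradient of h there. *)
Lemma dom_subdiff_dense a (e : R) : X a -> 0 < e ->
  exists2 u, dom_subdiff h u & `|u - a| < e.
Proof.
move=> Xa e0.
pose q v : R := \sum_i (v2r (v - a) 0 i) ^+ 2.
have q0 v : 0 <= q v by apply: sumr_ge0 => i _; exact: sqr_ge0.
have [C C0 HC] := @norm_r2v_le R V.
have qn v : `|v - a| ^+ 2 <= C ^+ 2 * q v.
  apply: (@le_trans _ _ ((C * `|v2r (v - a)|) ^+ 2)).
    have := HC (v2r (v - a)); rewrite v2rK => vC.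
    by apply: lerXn2r; rewrite ?nnegrE// mulr_ge0// ltW.
  rewrite exprMn ler_pM2l ?exprn_gt0//.
  have [->|/eqP v0] := eqVneq (v2r (v - a)) 0; first by rewrite normr0 expr0n/= q0.
  have /mx_norm_neq0[[i0 j0] /= vij] : mx_norm (v2r (v - a)) != 0.
    by apply/eqP => /mx_norm_eq0.
  have -> : `|v2r (v - a)| = `|v2r (v - a) i0 j0| by [].
  rewrite (ord1 i0) real_normK ?num_real// /q (bigD1 j0)//= lerDl.
  by apply: sumr_ge0 => i _; exact: sqr_ge0.
have qc : continuous q.
  apply: continuous_big => [|i _ v]; first exact: add_continuous.
  have cv : {for v, continuous (fun v => v2r (v - a) 0 i)}.
    apply: (@continuous_comp _ _ _ (fun v => v - a) (fun v : V => v2r v 0 i)).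
      by apply: continuousB => //; exact: cst_continuous.
    exact: continuous_coord.
  exact: (continuousM cv cv).
have [u /set_mem Xu0 um] := compact_EVT_min X_nonempty X_compact hr_continuous.
(* Comparing the minimizer [w] with [a] gives [N * q w <= hr a - hr u]; with this [N] it follows
   that [C ^+ 2 * q w < e ^+ 2]. *)
pose N : R := C ^+ 2 * (hr a - hr u + 1) / e ^+ 2.
have N0 : 0 < N.
  rewrite !mulr_gt0 ?exprn_gt0// ?invr_gt0 ?exprn_gt0//.
  by have := um a (mem_set Xa); lra.
have cF : {within X, continuous (fun v => hr v + N * q v)}.
  move=> v; apply: continuousD; first exact: hr_continuous.
  by apply: continuousM; [exact: cst_continuous|exact: continuous_subspaceT].
have [w /set_mem Xw wm] := compact_EVT_min X_nonempty X_compact cF.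
exists w; last first.
  have wa := wm a (mem_set Xa).
  have qa : q a = 0 by rewrite /q big1// => i _; rewrite subrr linear0 mxE expr0n.
  rewrite qa mulr0 addr0 in wa.
  have uw := um w (mem_set Xw).
  rewrite -(@ltr_pXn2r _ 2)// ?nnegrE// ?ltW//.
  apply: (le_lt_trans (qn w)).
  have : N * q w < hr a - hr u + 1 by lra.
  have B0 : 0 < hr a - hr u + 1 by have := um a (mem_set Xa); lra.
  rewrite /N mulrAC ltr_pdivrMr ?exprn_gt0// => NB.
  by rewrite -(ltr_pM2l B0) mulrA [_ * C ^+ 2]mulrC.
(* [y] is minus the gradient of the penalty [N * q] at [w]. *)
have [y Hy] : exists y, forall v, pairing y v =
    \sum_i (- 2 * N * v2r (w - a) 0 i) * v2r v 0 i.
  apply: linear_pairing => c v v'; rewrite mulr_sumr -big_split/=.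
  by apply: eq_bigr => i _; rewrite linearP !mxE; ring.
exists y; apply/subdiffP; split=> // x' Xx'.
rewrite Hy.
pose b := \sum_i v2r (w - a) 0 i * v2r (x' - w) 0 i.
have -> : \sum_i (- 2 * N * v2r (w - a) 0 i) * v2r (x' - w) 0 i = - 2 * N * b.
  by rewrite mulr_sumr; apply: eq_bigr => i _; ring.
pose c := \sum_i v2r (x' - w) 0 i ^+ 2.
suff : 0 <= hr x' - hr w + 2 * N * b by lra.
(* Minimality of [w] is tested along the segment to [x'], where convexity bounds [h]; dividing by
   [s] leaves an affine function of [s]. *)
apply: (@ge0_of_affine_ge0 _ (N * c)) => s /andP[s0 s1].
have [Xs hs] := hr_convex Xw Xx' (introT andP (conj s0 s1)).
have := wm _ (mem_set Xs).
set ws := s *: x' + _ in Xs hs *.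
have -> : q ws = q w + 2 * s * b + s ^+ 2 * c.
  rewrite /q /b /c !mulr_sumr -!big_split/=; apply: eq_bigr => i _.
  have -> : ws - a = (w - a) + s *: (x' - w).
    rewrite /ws scalerBl scale1r scalerBr [RHS]addrACA [w + _]addrC.
    by rewrite [- a + _]addrC !addrA; congr (_ - a); rewrite addrC addrA.
  by rewrite linearD linearZ !mxE; ring.
move=> le1.
rewrite -(pmulr_rge0 _ s0).
suff : 0 <= s * hr x' + (1 - s) * hr w - hr w + N * (2 * s * b + s ^+ 2 * c).
  by congr (0 <= _); ring.
by lra.
Qed.

(* Monotonicity of the subdifferential along points of its domain that approach
   x in the direction x' - x; dom_subdiff h need not contain the segment, so the
   points x + s (x' - x) are first moved into it by at most s^2. *)
Lemma subgradient_le_selection x x' y : subdiff h x y -> X x' ->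
  pairing y (x' - x) <= pairing (gradh x) (x' - x).
Proof.
move=> xy Xx'; have Dx : dom_subdiff h x by exists y.
have Xx := dom_subdiff_sub Dx.
set v := x' - x; set g := gradh x.
rewrite -subr_ge0 -pairingB.
pose M := dual_norm (g - y).
have M0 : 0 <= M by exact: dual_norm_ge0.
apply/ler_addgt0Pr => e e0; rewrite -(opprK e) -lerBlDr opprK add0r.
(* Error budget after division by [s]: [k] times the norm of [v] for replacing [gradh u] by [g], and
   [(k + M) * s <= k * (1 + M)] for the shift of size [s ^+ 2]. The total is at most [k * B = e]. *)
pose B := `|v| + M + 2.
have B2 : 2 <= B by rewrite lerDr addr_ge0.
pose k := e / B.
have k0 : 0 < k by rewrite divr_gt0//; lra.
have [r r0 Hr] := continuous_selection_dist h_selection Dx k0.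
pose s := Num.min (1 / 2) (Num.min (k / 2) (r / (2 * B))).
have s0 : 0 < s by rewrite !lt_min !divr_gt0//; lra.
have s1 : s < 1 by rewrite gt_min; apply/orP; left; lra.
have sk : s <= k / 2 by rewrite !ge_min lexx orbT.
have sr : s <= r / (2 * B) by rewrite !ge_min lexx !orbT.
have [Xs _] := hr_convex Xx Xx' (introT andP (conj s0 s1)).
set xs := s *: x' + _ in Xs.
have [u Du uxs] := dom_subdiff_dense Xs (exprn_gt0 2 s0).
have uE : u - x = s *: v + (u - xs).
  have -> : xs = x + s *: v by rewrite /xs scalerBl scale1r scalerBr addrCA.
  by rewrite opprD addrCA [s *: v + _]addrC subrK.
have mono : 0 <= pairing (gradh u - y) (u - x).
  have := h_selection.1 u Du x; have := xy u.
  rewrite (h_fin Xx) (h_fin (dom_subdiff_sub Du)) -!EFinD !lee_fin.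
  by rewrite pairingB -(opprB u x) pairingNr; lra.
have us : `|u - x| < r.
  rewrite uE; apply: (le_lt_trans (ler_normD _ _)); rewrite normrZ gtr0_norm//.
  have : s ^+ 2 <= s by rewrite expr2 ler_piMr// ltW.
  have : s * (2 * B) <= r by rewrite -ler_pdivlMr//; lra.
  rewrite /B; nra.
have kg := Hr u Du us.
have p1 : pairing (gradh u - y) (u - xs) <= (k + M) * s ^+ 2.
  apply: (le_trans (pairing_le _ _)); apply: ler_pM => //; rewrite ?dual_norm_ge0//.
    rewrite -(subrKA g); apply: (le_trans (dual_normD _ _)).
    by rewrite lerD// ltW.
  exact: ltW.
have p2 : pairing (gradh u - g) v <= k * `|v|.
  by apply: (le_trans (pairing_le _ _)); rewrite ler_wpM2r// ltW.
have p3 : pairing (gradh u - y) v = pairing (gradh u - g) v + pairing (g - y) v.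
  by rewrite -pairingD subrKA.
rewrite uE pairingDr pairingZr p3 in mono.
have p4 : 0 <= s * (k * `|v| + pairing (g - y) v + (k + M) * s).
  have : s * pairing (gradh u - g) v <= s * (k * `|v|) by rewrite ler_wpM2l// ltW.
  lra.
rewrite pmulr_rge0// in p4.
have p5 : (k + M) * s <= k * (1 + M).
  have : k * s <= k by rewrite ler_piMr// ltW.
  have : M * s <= M * k by rewrite ler_wpM2l//; lra.
  lra.
have p6 : e = k * B by rewrite divfK//; lra.
by rewrite p6 /B; nra.
Qed.

(** A maximizer exists by compactness, so [xget] does not fall back on its default 0. *)
Lemma mirror_map_argmax y : X (mirror_map X h y) /\ forall x', X x' ->
  pairing y x' - hr x' <= pairing y (mirror_map X h y) - hr (mirror_map X h y).
Proof.
pose A := [set x | X x /\ forall x', X x' ->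
  ((pairing y x')%:E - h x' <= (pairing y x)%:E - h x)%E].
have cF : {within X, continuous (fun v => pairing y v - hr v)}.
  move=> v; apply: continuousB; last exact: hr_continuous.
  apply: continuous_subspaceT; have [C C0 HC] := @pairing_bound R V.
  apply: (@lipschitz_continuous _ (C * (\sum_i `|pairing y (vbase i)|) + 1)).
    by rewrite ltr_wpDl// mulr_ge0 ?sumr_ge0// ltW.
  move=> a b; rewrite -pairingBr; apply: (le_trans (HC _ _)).
  by rewrite ler_wpM2r// lerDl.
have [c /set_mem Xc cm] := compact_EVT_max X_nonempty X_compact cF.
have Ac : A c.
  split=> // x' Xx'; rewrite (h_fin Xx') (h_fin Xc) -!EFinB lee_fin.
  exact/cm/mem_set.
have [XQ Qm] : A (mirror_map X h y) by apply: xgetPex; exists c.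
split=> // x' Xx'; have := Qm x' Xx'.
by rewrite (h_fin Xx') (h_fin XQ) -!EFinB lee_fin.
Qed.

Lemma mirror_map_in y : X (mirror_map X h y).
Proof. by have [] := mirror_map_argmax y. Qed.

Lemma mirror_map_subdiff y : subdiff h (mirror_map X h y) y.
Proof.
have [XQ Qm] := mirror_map_argmax y.
apply/subdiffP; split=> // x' /Qm; rewrite pairingBr; lra.
Qed.

Lemma mirror_map_dom y : dom_subdiff h (mirror_map X h y).
Proof. by exists y; exact: mirror_map_subdiff. Qed.

(** Strong convexity is assumed for [gradh] only; [subgradient_le_selection] transfers it to the
    subgradient [y], so that the Fenchel coupling dominates the squared distance. *)
Lemma mirror_map_strong y x' : X x' ->
  K / 2 * `|x' - mirror_map X h y| ^+ 2 <=
  hr x' - hr (mirror_map X h y) - pairing y (x' - mirror_map X h y).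
Proof.
move=> Xx'; set x := mirror_map X h y.
have := h_strongly_convex (mirror_map_dom y) Xx'.
rewrite (h_fin Xx') (h_fin (mirror_map_in y)) -EFinD lee_fin.
have := subgradient_le_selection (mirror_map_subdiff y) Xx'.
rewrite -/x; lra.
Qed.

Lemma mirror_map_cocoercive y y' :
  K * `|mirror_map X h y' - mirror_map X h y| ^+ 2 <=
  pairing (y' - y) (mirror_map X h y' - mirror_map X h y).
Proof.
have := mirror_map_strong y (mirror_map_in y').
have := mirror_map_strong y' (mirror_map_in y).
rewrite distrC pairingB -(opprB (mirror_map X h y')) pairingNr; lra.
Qed.

(** This bound is the source of the measurability of the iterates. *)
Lemma mirror_map_lipschitz y y' :
  K * `|mirror_map X h y' - mirror_map X h y| <= dual_norm (y' - y).
Proof.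
have := mirror_map_cocoercive y y'; set v := _ - mirror_map X h y.
have [->|v0] := eqVneq `|v| 0; first by rewrite mulr0 dual_norm_ge0.
move=> /le_trans/(_ (pairing_le _ _)); rewrite expr2 mulrA ler_pM2r//.
by rewrite lt_neqAle eq_sym v0 normr_ge0.
Qed.

(** * Energy of a dual state and its one-step descent *)

Context {f : V -> \bar R} {gradf : V -> dual V} {mu L p : R} {xs : V}.
Context (f_finite : forall x, X x -> f x \is a fin_num)
  (gradf_defined : dom_subdiff h `<=` dom_subdiff f)
  (p_gt1 : 1 < p) (p_le2 : p <= 2)
  (f_strongly_convex : strongly_convex (X `&` dom_subdiff f) X f gradf mu)
  (f_smooth : relatively_smooth X f gradf h gradh L)
  (xs_min : is_minimizer X f xs).

Let fr x := fine (f x).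

(* The Fenchel coupling of xs and eta y, plus eta times the optimality gap at
   the primal iterate. *)
Definition energy (eta : R) (y : dual V) : R :=
  let x := mirror_map X h (eta *: y) in
  hr xs - hr x - pairing (eta *: y) (xs - x) + eta * (fr x - fr xs).

Lemma diam_ub x x' : X x -> X x' -> `|x' - x| <= diam X.
Proof.
move=> Xx Xx'; apply: ub_le_sup; last by exists x => //; exists x'.
have [M [_ /(_ (M + 1))]] := compact_bounded X_compact.
rewrite ltrDl ltr01 => /(_ isT) XM.
exists (M + 1 + (M + 1)) => _ [v Xv [w Xw <-]].
by apply: (le_trans (ler_normB _ _)); rewrite lerD// XM.
Qed.

Lemma fr_min x : X x -> fr xs <= fr x.
Proof.
move=> Xx; have := xs_min.2 x Xx.
rewrite -(fineK (f_finite Xx)) -(fineK (f_finite xs_min.1)).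
by rewrite lee_fin.
Qed.

Lemma energy_ge0 eta y : 0 <= eta -> 0 <= energy eta y.
Proof.
move=> eta0; rewrite /energy; set x := mirror_map _ _ _.
rewrite addr_ge0//.
  apply: le_trans (mirror_map_strong _ xs_min.1).
  by rewrite mulr_ge0// ?sqr_ge0// divr_ge0// ltW.
by rewrite mulr_ge0// subr_ge0; exact/fr_min/mirror_map_in.
Qed.

(** Deterministic, for one value [u] of the noise. The term linear in [u] is kept because its mean
    vanishes; the other effect of [u], through the next iterate, is not centred and is paid for by
    the p-th power of the dual norm. *)
Lemma energy_descent eta y u x : 0 < eta -> eta * L <= p^-1 ->
  x = mirror_map X h (eta *: y) ->
  energy eta (y - (gradf x + u)) <=
  energy eta y - eta * (mu / 2) * `|x - xs| ^+ 2 + eta * pairing u (xs - x)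
  + p^-1 * (diam X `^ (2 - p) * (2 / K) `^ (p - 1) * eta `^ p) * dual_norm u `^ p.
Proof.
move=> eta0 etaL xE; rewrite /energy -xE; set y' := y - _.
set x' := mirror_map X h (eta *: y').
have Xx : X x by rewrite xE; exact: mirror_map_in.
have Xx' : X x' by exact: mirror_map_in.
have Dx : dom_subdiff h x by rewrite xE; exact: mirror_map_dom.
have Df : dom_subdiff f x by exact: gradf_defined.
have fE v : X v -> f v = (fr v)%:E by move=> Xv; rewrite fineK// f_finite.
have sub := subgradient_le_selection (mirror_map_subdiff (eta *: y)) Xx'.
rewrite -xE in sub.
have sch := h_strongly_convex Dx Xx'.
rewrite !h_fin// -!EFinD lee_fin in sch.
have scf := f_strongly_convex (conj Xx Df) xs_min.1.
rewrite !fE//= in scf; last exact: xs_min.1.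
rewrite -!EFinD lee_fin in scf.
have rs := f_smooth Dx Xx'.
rewrite /bregman !fE// !h_fin// -!EFinB -EFinM -!EFinD lee_fin in rs.
set Dh := _ - pairing (gradh x) _ in rs.
have DhK : K / 2 * `|x' - x| ^+ 2 <= Dh by rewrite /Dh; lra.
have Dh0 : 0 <= Dh.
  by apply: le_trans DhK; rewrite mulr_ge0 ?sqr_ge0// divr_ge0// ltW.
have yo : eta * pairing u (x - x') <= (1 - p^-1) * (K / 2) * `|x' - x| ^+ 2
    + p^-1 * (diam X `^ (2 - p) * (2 / K) `^ (p - 1) * (eta `^ p * dual_norm u `^ p)).
  rewrite -powRM ?dual_norm_ge0 ?(ltW eta0)//.
  apply: (le_trans _ (young_descent _ _ (diam_ub Xx Xx') K_gt0 p_gt1 p_le2)).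
  - rewrite -mulrA ler_wpM2l ?(ltW eta0)// distrC.
    exact: pairing_le.
  - by rewrite mulr_ge0 ?dual_norm_ge0 ?ltW.
  - exact: normr_ge0.
(* [Dh] is spent in two shares: 1/p for relative smoothness, and 1 - 1/p for the quadratic term of
   [yo]. *)
have LD : eta * L * Dh <= p^-1 * Dh by rewrite ler_wpM2r.
have p11 : 0 <= 1 - p^-1 by rewrite subr_ge0 invf_le1 ?(lt_trans ltr01)// ltW.
have KD : (1 - p^-1) * (K / 2 * `|x' - x| ^+ 2) <= (1 - p^-1) * Dh.
  by rewrite ler_wpM2l.
have rs' := ler_wpM2l (ltW eta0) rs.
have scf' := ler_wpM2l (ltW eta0) scf.
have pE : pairing (eta *: y') (xs - x') = pairing (eta *: y) (xs - x)
    - pairing (eta *: y) (x' - x) - eta * pairing (gradf x) (xs - x)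
    + eta * pairing (gradf x) (x' - x) - eta * pairing u (xs - x)
    - eta * pairing u (x - x').
  rewrite /y' !pairingZ !pairingB !pairingD !pairingBr; ring.
rewrite pE distrC.
rewrite /Dh in rs' LD KD *.
(* The estimates leave minus [eta] times the gap at [x], which is nonpositive. *)
have := ler_wpM2l (ltW eta0) (fr_min Xx).
lra.
Qed.

End mirror.

Arguments energy {R V} X h f xs eta y.

(** * Independence and drift *)

Section independence.
Context {R : realType} {d d1 d2 : measure_display} {Omega : measurableType d}
  {P : probability Omega R} {T1 : measurableType d1} {T2 : measurableType d2}.
Local Open Scope ereal_scope.

(* Freezing lemma: given u, the variable v may be integrated out first. *)
Lemma integral_indep_le (u : {RV P >-> T1}) (v : {RV P >-> T2})
    (psi : T1 * T2 -> \bar R) (phi : T1 -> \bar R) :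
  (forall A B, measurable A -> measurable B ->
     P (u @^-1` A `&` v @^-1` B) = P (u @^-1` A) * P (v @^-1` B)) ->
  measurable_fun [set: T1 * T2] psi -> (forall z, 0 <= psi z) ->
  measurable_fun setT phi ->
  (forall x, \int[P]_w psi (x, v w) <= phi x) ->
  \int[P]_w psi (u w, v w) <= \int[P]_w phi (u w).
Proof.
move=> indep mpsi psi0 mphi psiphi.
pose uv w := (u w, v w).
have muv : measurable_fun setT uv by exact: measurable_fun_pair.
pose uvM := isMeasurableFun.Build _ _ _ _ uv muv.
pose UV : {RV P >-> (T1 * T2)%type} := HB.pack uv uvM.
have -> : \int[P]_w psi (u w, v w) = \int[distribution P UV]_z psi z.
  by rewrite ge0_integral_distribution.
have -> : \int[distribution P UV]_z psi z
    = \int[distribution P u \x distribution P v]_z psi z.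
  (* By independence the law of the pair agrees with the product of the laws on rectangles, hence
     everywhere. *)
  apply: eq_measure_integral => A mA _; apply/esym.
  exact: product_measure_unique.
rewrite fubini_tonelli1//.
have psiF x : fubini_F (distribution P v) psi x = \int[P]_w psi (x, v w).
  rewrite /fubini_F ge0_integral_distribution//.
  exact: measurableT_comp mpsi (measurable_pair1 x).
have phi0 x : 0 <= phi x.
  by apply: le_trans (psiphi x); apply: integral_ge0 => w _.
rewrite -(@ge0_integral_distribution _ _ _ _ _ P u phi)//.
apply: ge0_le_integral => //.
- by move=> x _; rewrite psiF integral_ge0.
- exact: measurable_fun_fubini_tonelli_F.
- by move=> x _; rewrite psiF.
Qed.

End independence.

(** * The sigma-algebra of the past seeds *)

Section past.
Context {R : realType} {d d' : measure_display} {Omega : measurableType d}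
  {P : probability Omega R} {T : measurableType d'}.
Context (xi : nat -> {RV P >-> T}) (xi_iid : iid xi).

Definition cylinder (t : nat) : set (set Omega) :=
  [set E | exists2 A : nat -> set T, (forall s, measurable (A s)) &
     E = \bigcap_(s in `I_t) (xi s @^-1` A s)].

Lemma cylinder_measurable t : cylinder t `<=` measurable.
Proof.
move=> _ [A mA ->]; apply: bigcap_measurableType => s _.
by rewrite -[X in measurable X]setTI; exact: measurable_funP.
Qed.

Lemma cylinder_setI t : setI_closed (cylinder t).
Proof.
move=> _ _ [A mA ->] [B mB ->]; exists (fun s => A s `&` B s).
  by move=> s; exact: measurableI.
by rewrite -bigcapI; apply: eq_bigcapr => s _; rewrite preimage_setI.
Qed.

Lemma cylinderT t : cylinder t setT.
Proof.
by exists (fun=> setT) => //; apply/seteqP; split.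
Qed.

(** [Omega] with a coarser sigma-algebra, as a type of its own: being determined by the seeds 0,
    ..., t - 1 is then plain measurability on [past t]. *)
Definition past t := g_sigma_algebraType (cylinder t).

Lemma past_measurable t (A : set Omega) :
  (measurable : set (set (past t))) A -> measurable A.
Proof.
move: A; apply: smallest_sub; last exact: cylinder_measurable.
exact: sigma_algebra_measurable.
Qed.

Lemma pastS t (A : set Omega) :
  (measurable : set (set (past t))) A -> (measurable : set (set (past t.+1))) A.
Proof.
move: A; apply: smallest_sub; first exact: smallest_sigma_algebra.
move=> _ [A mA ->]; apply: sub_sigma_algebra.
exists (fun s => if (s < t)%N then A s else setT).
  by move=> s; case: ifP.
apply/seteqP; split=> w Aw s /= st; last first.
  by have := Aw s (ltnW st); rewrite st.
by case: ifPn => // st'; exact: Aw.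
Qed.

Lemma measurable_past t : measurable_fun [set: past t.+1] (xi t : past t.+1 -> T).
Proof.
move=> _ B mB; rewrite setTI; apply: sub_sigma_algebra.
exists (fun s => if s == t then B else setT).
  by move=> s; case: ifP.
apply/seteqP; split=> w.
  by move=> Bw s _; case: ifPn => // /eqP ->.
by move=> /(_ t (ltnSn t)); rewrite eqxx.
Qed.

(** Restriction of [P] to the event on seed [t], and [P] scaled by the probability of that event,
    are finite measures that agree on the pi-system of cylinders, hence on the sigma-algebra it
    generates. *)
Lemma past_indep t (A : set Omega) (B : set T) :
  (measurable : set (set (past t))) A -> measurable B ->
  (P (A `&` xi t @^-1` B) = P A * P (xi t @^-1` B))%E.
Proof.
move=> mA mB.
have mxB : measurable (xi t @^-1` B).
  by rewrite -[X in measurable X]setTI; exact: measurable_funP.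
pose k : {nonneg R} := NngNum (fine_ge0 (measure_ge0 P (xi t @^-1` B))).
have kE : ((k%:num)%:E = P (xi t @^-1` B))%E by rewrite /= fineK ?fin_num_measure.
have mE D : (mscale k P D = P (xi t @^-1` B) * P D)%E by rewrite -kE.
rewrite muleC -mE.
apply: (@g_sigma_algebra_measure_unique _ _ _ (cylinder t) _ (fun=> setT)
  _ _ (mrestr P mxB) (mscale k P)) => //.
- exact: cylinder_measurable.
- by move=> _; exact: cylinderT.
- by rewrite bigcup_const//; exists 0%N.
- exact: cylinder_setI.
- move=> _ [C mC ->]; rewrite /= mE /mrestr.
  (* [B] becomes the constraint on seed [t], so that the intersection is again a cylinder, one seed
     longer. *)
  pose C' s := if s == t then B else C s.
  have mC' s : measurable (C' s) by rewrite /C'; case: ifP.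
  have CC' s : s \in iota 0 t -> C s = C' s.
    by rewrite mem_iota add0n /C' => /andP[_]; case: eqP => // ->; rewrite ltnn.
  have IE n : [set` iota 0 n] = `I_n.
    by apply/seteqP; split=> s; rewrite /mkset mem_iota add0n.
  have e1 := xi_iid.1 (iota 0 t) C (iota_uniq 0 t) mC.
  have e2 := xi_iid.1 (iota 0 t.+1) C' (iota_uniq 0 t.+1) mC'.
  rewrite !IE in e1 e2; rewrite muleC e1.
  transitivity (P (\bigcap_(s < t.+1) (xi s @^-1` C' s))).
    congr (P _); apply/seteqP; split=> w.
      move=> [Cw Bw] s; rewrite /mkset ltnS leq_eqVlt /C'.
      by case: eqP => [-> _//|_ /= st]; exact: Cw.
    move=> Cw; split.
      move=> s st; have := Cw s (ltnW st); rewrite -CC'//.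
      by rewrite mem_iota add0n.
    by have := Cw t (ltnSn t); rewrite /C' eqxx.
  rewrite e2 -addn1 iotaD big_cat/= big_seq1 add0n; congr (_ * _)%E.
    by apply: eq_big_seq => s st; rewrite CC'.
  by rewrite /C' eqxx.
- move=> _; rewrite /mrestr; apply: (le_lt_trans (probability_le1 _ _)).
    exact: measurableI.
  exact: ltry.
Qed.

End past.

(** * Foster-Lyapunov drift along a recursion driven by i.i.d. seeds *)

Section drift.
Context {R : realType} {d d' ds : measure_display} {Omega : measurableType d}
  {P : probability Omega R} {T : measurableType d'} {S : measurableType ds}.
Context {xi : nat -> {RV P >-> T}} (xi_iid : iid xi).
Context {next : S * T -> S} (next_measurable : measurable_fun [set: S * T] next).
Context {s0 : S} {state : nat -> Omega -> S}.
Context (state0 : forall w, state 0 w = s0)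
  (stateS : forall t w, state t.+1 w = next (state t w, xi t w)).
Context {bad : set S} (bad_measurable : measurable bad).
Context {Psi : S -> R} {c : R} (Psi_measurable : measurable_fun setT Psi)
  (Psi_ge0 : forall s, 0 <= Psi s) (c_ge0 : 0 <= c).
Context (drift : forall t s, bad s ->
  (\int[P]_w (Psi (next (s, xi t w)) + c)%:E <= (Psi s)%:E)%E).

Definition stay (t : nat) : set Omega := \bigcap_(s < t) (state s @^-1` bad).

Lemma state_measurable t : measurable_fun [set: past xi t] (state t : past xi t -> S).
Proof.
elim: t => [|t IH].
  by rewrite (_ : state 0 = fun=> s0)//; apply/funext.
have -> : state t.+1 = next \o (fun w => (state t w, xi t w)).
  by apply/funext => w; rewrite stateS.
apply: measurableT_comp => //; apply: measurable_fun_pair; last first.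
  exact: measurable_past.
move=> _ A mA; rewrite setTI; apply: pastS.
by rewrite -[X in measurable X]setTI; exact: IH.
Qed.

(** The event is predictable: it involves the states up to [t], hence only the seeds before [t],
    although its index is [t.+1]. *)
Lemma stay_measurable t : (measurable : set (set (past xi t))) (stay t.+1).
Proof.
apply: bigcap_measurableType => s; rewrite /mkset ltnS => st.
have : (measurable : set (set (past xi s))) (state s @^-1` bad).
  by rewrite -[X in measurable X]setTI; exact: state_measurable.
rewrite -(subnKC st); elim: (t - s)%N => [|k IH]; first by rewrite addn0.
by rewrite addnS => /IH /pastS.
Qed.

Lemma stay_measurableT t : measurable (stay t).
Proof.
case: t => [|t].
  by rewrite (_ : stay 0 = setT)//; apply/seteqP; split.
by apply: (@past_measurable _ _ _ _ _ _ xi t); exact: stay_measurable.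
Qed.

Lemma stayS_sub t : stay t.+1 `<=` stay t.
Proof. by move=> w Bw s st; apply: Bw; exact: ltnW. Qed.

Lemma past_measurable_fun t d2 (T2 : measurableType d2) (g : Omega -> T2) :
  measurable_fun [set: past xi t] (g : past xi t -> T2) ->
  measurable_fun [set: Omega] g.
Proof.
move=> mg _ A mA; rewrite setTI; apply: (@past_measurable _ _ _ _ _ _ xi t).
by rewrite -[X in measurable X]setTI; exact: mg.
Qed.

Local Open Scope ereal_scope.

(** Given the past, [stay t.+1] and [state t] are frozen and seed [t] is independent of them. On
    [stay t.+1] the state at [t] is bad, so [drift] applies; off it the integrands vanish. *)
Lemma drift_step t :
  \int[P]_w (\1_(stay t.+1) w * Psi (state t.+1 w))%:E + c%:E * P (stay t.+1)
  <= \int[P]_w (\1_(stay t) w * Psi (state t w))%:E.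
Proof.
(* The identity, seen as a random variable with values in [past xi t], brings the entire past into
   the freezing lemma. *)
have midt : measurable_fun [set: Omega] (id : Omega -> past xi t).
  by apply: (@past_measurable_fun t) => _ A mA; rewrite setTI; exact: mA.
pose idM := isMeasurableFun.Build _ _ _ _ (id : Omega -> past xi t) midt.
pose ID : {RV P >-> past xi t} := HB.pack (id : Omega -> past xi t) idM.
pose psi (z : past xi t * T) : \bar R :=
  (\1_(stay t.+1) z.1 * (Psi (next (state t z.1, z.2)) + c))%:E.
pose phi (w : past xi t) : \bar R := (\1_(stay t.+1) w * Psi (state t w))%:E.
have m1 : measurable_fun [set: past xi t] (\1_(stay t.+1) : past xi t -> R).
  exact: (@measurable_indic _ (past xi t) R setT (stay t.+1) (@stay_measurable t)).
have mS := @state_measurable t.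
have mphi : measurable_fun [set: past xi t] phi.
  apply/measurable_EFinP; apply: measurable_funM => //.
  exact: measurableT_comp.
have mpsi : measurable_fun [set: past xi t * T] psi.
  apply/measurable_EFinP; apply: measurable_funM.
    exact: (measurableT_comp m1 measurable_fst).
  apply: measurable_funD => //; apply: measurableT_comp => //.
  apply: measurableT_comp => //; apply: measurable_fun_pair => //.
  exact: (measurableT_comp mS measurable_fst).
have ind_ge0 A w : (0 <= \1_A w :> R)%R by rewrite indicE.
have psiphi w : \int[P]_w' psi (w, xi t w') <= phi w.
  rewrite /phi indicE; have [wA|wA] := boolP (w \in stay t.+1).
    rewrite mul1r (eq_integral (fun w' => (Psi (next (state t w, xi t w')) + c)%:E)).
      by apply: drift; move/set_mem: wA => /(_ t); apply => /=.
    by move=> w' _; rewrite /psi/= indicE wA mul1r.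
  rewrite mul0r (eq_integral (fun=> 0)) ?integral0// => w' _.
  by rewrite /psi/= indicE (negbTE wA) mul0r.
have indep A B : measurable A -> measurable B ->
    P (ID @^-1` A `&` xi t @^-1` B) = P (ID @^-1` A) * P (xi t @^-1` B).
  by move=> mA mB; exact: past_indep.
have psi0 z : 0 <= psi z by rewrite lee_fin mulr_ge0// addr_ge0.
have := integral_indep_le indep mpsi psi0 mphi psiphi.
have mS1 := @past_measurable_fun t.+1 _ _ _ (@state_measurable t.+1).
have mst u : measurable_fun [set: Omega] (\1_(stay u) : Omega -> R).
  exact/measurable_indic/stay_measurableT.
have -> : \int[P]_w psi (ID w, xi t w) =
    \int[P]_w (\1_(stay t.+1) w * Psi (state t.+1 w))%:E + c%:E * P (stay t.+1).
  have -> : P (stay t.+1) = \int[P]_w (\1_(stay t.+1) w)%:E.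
    by rewrite integral_indic ?setIT//; exact: stay_measurableT.
  have -> : c%:E * \int[P]_w (\1_(stay t.+1) w)%:E
      = \int[P]_w (c * \1_(stay t.+1) w)%:E.
    under [RHS]eq_integral do rewrite EFinM.
    by rewrite ge0_integralZl//; exact/measurable_EFinP.
  rewrite -ge0_integralD//; last 4 first.
  - by move=> w _; rewrite lee_fin mulr_ge0.
  - apply/measurable_EFinP; apply: measurable_funM => //.
    exact: (measurableT_comp Psi_measurable mS1).
  - by move=> w _; rewrite lee_fin mulr_ge0.
  - by apply/measurable_EFinP; exact: measurable_funM.
  apply: eq_integral => w _; rewrite /psi/= stateS -EFinD.
  by rewrite mulrDr [(c * _)%R]mulrC.
(* [stay t.+1] is contained in [stay t], and [Psi] is nonnegative. *)
move=> /le_trans; apply; apply: ge0_le_integral => //.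
- by move=> w _; rewrite lee_fin mulr_ge0.
- exact: (@past_measurable_fun t) mphi.
- apply/measurable_EFinP; apply: measurable_funM => //.
  apply: measurableT_comp => //.
  exact: (@past_measurable_fun t) mS.
- move=> w _; rewrite lee_fin ler_wpM2r// !indicE.
  case: (boolP (w \in stay t.+1)) => // /set_mem /stayS_sub /mem_set -> //.
Qed.

(** The one-step inequalities telescope up to a deterministic horizon; the remaining integral of
    [Psi] is nonnegative and is dropped, which takes the place of optional stopping. *)
Lemma drift_sum n :
  c%:E * \sum_(t < n) P (stay t.+1) <= (Psi s0)%:E.
Proof.
suff : \int[P]_w (\1_(stay n) w * Psi (state n w))%:E
    + c%:E * \sum_(t < n) P (stay t.+1) <= (Psi s0)%:E.
  apply: le_trans; rewrite leeDr//; apply: integral_ge0 => w _.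
  by rewrite lee_fin mulr_ge0.
elim: n => [|n IH].
  rewrite big_ord0 mule0 adde0 /=.
  rewrite (eq_integral (fun=> (Psi s0)%:E)); last first.
    by move=> w _; rewrite state0 indicE mem_set ?mul1r.
  rewrite integral_cst// -[leRHS]mule1; apply: lee_wpmul2l.
    by rewrite lee_fin.
  exact: probability_le1.
apply: le_trans IH; rewrite big_ord_recr/= ge0_muleDr//; last first.
  by apply: sume_ge0 => i _.
by rewrite addeCA addeC leeD2r// drift_step.
Qed.

End drift.

(** * Measurability on the dual *)

Section dual_measurability.
Context {R : realType} {V : normedVectType R}.

Definition pointed_dual : Type := dual V.

HB.instance Definition _ := Choice.copy pointed_dual (dual V).
HB.instance Definition _ := isPointed.Build pointed_dual (0 : dual V).

(** With these generators a map into the dual is measurable as soon as its pairings with all vectors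
    are, which is the form in which the noise is given. *)
Definition pairing_cylinders : set (set pointed_dual) :=
  [set A | exists2 v : V, True &
     exists2 B : set R, measurable B & A = (fun y : dual V => pairing y v) @^-1` B].

Definition borel_dual := g_sigma_algebraType pairing_cylinders.

Lemma measurable_pairing (v : V) :
  measurable_fun [set: borel_dual] (fun y : borel_dual => pairing (y : dual V) v).
Proof.
move=> _ B mB; rewrite setTI; apply: sub_sigma_algebra.
by exists v => //; exists B.
Qed.

Lemma measurable_to_dual d (T : measurableType d) (F : T -> dual V) :
  (forall v, measurable_fun [set: T] (fun t => pairing (F t) v)) ->
  measurable_fun [set: T] (F : T -> borel_dual).
Proof.
move=> mF; apply: (@measurability _ _ T borel_dual setT F pairing_cylinders) => //.
move=> _ [_ [v _ [B mB ->]] <-].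
exact: (mF v measurableT B mB).
Qed.

Lemma measurable_gt d (T : measurableType d) (g : T -> R) :
  (forall a, measurable [set t | a < g t]) -> measurable_fun [set: T] g.
Proof.
move=> mg; apply: (measurability _ (RGenOInfty.measurableE R)) => //.
move=> _ [_ [a ->] <-]; rewrite setTI.
rewrite (_ : _ @^-1` _ = [set t | a < g t])//.
by apply/seteqP; split=> t /=; rewrite in_itv/= andbT.
Qed.

(* An open set of the dual is a countable union of rational coordinate boxes. *)
Lemma measurable_dual_open (A : set (dual V)) :
  (forall y, A y -> exists2 r : R, 0 < r & forall y', dual_norm (y' - y) < r -> A y') ->
  measurable (A : set borel_dual).
Proof.
move=> Aopen.
pose box (qk : {ffun 'I_(dim V) -> rat} * nat) : set (dual V) :=
  \bigcap_(i in [set: 'I_(dim V)])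
    [set y | `|pairing y (vbase i) - ratr (qk.1 i)| < qk.2.+1%:R^-1].
have mbox qk : measurable (box qk : set borel_dual).
  apply: fin_bigcap_measurable => // i _.
  have mg : measurable_fun [set: borel_dual]
      (fun y : borel_dual => `|pairing (y : dual V) (vbase i) - ratr (qk.1 i)|).
    apply: measurableT_comp => //; apply: measurable_funB => //.
    exact: measurable_pairing.
  pose J := `]-oo, (qk.2.+1%:R^-1 : R)[%classic.
  rewrite (_ : mkset _ = (fun y : dual V =>
    `|pairing y (vbase i) - ratr (qk.1 i)|) @^-1` J); last first.
    by apply/seteqP; split=> y; rewrite /J/= in_itv.
  by rewrite -[X in measurable X]setTI; exact: (mg measurableT J (measurable_itv _)).
pose F qk : set (dual V) := if pselect (box qk `<=` A) then box qk else set0.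
have -> : A = \bigcup_qk (F qk).
  apply/seteqP; split=> [y Ay|y [qk _]]; last first.
    by rewrite /F; case: pselect => //= sA; exact: sA.
  have [r r0 Ar] := Aopen y Ay.
  have [C C0 HC] := @dual_norm_coord R V.
  (* Two points of a box of half-width below [e] differ by less than [2 * e] in each basis
     evaluation, and [C * (dim V)%:R * (2 * e) < r]. *)
  pose e := r / (C * (dim V)%:R * 2 + 1).
  have e0 : 0 < e by rewrite divr_gt0// ltr_wpDl// !mulr_ge0// ltW.
  pose k := Num.truncn e^-1.
  have ke : k.+1%:R^-1 < e.
    rewrite invf_plt ?posrE//; exact: truncnS_gt.
  have /choice[q Hq] (i : 'I_(dim V)) : exists q : rat,
      `|pairing y (vbase i) - ratr q| < k.+1%:R^-1.
    have /rat_in_itvoo[q] : pairing y (vbase i) - k.+1%:R^-1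
        < pairing y (vbase i) + k.+1%:R^-1.
      by rewrite ltrD2l gtrN// invr_gt0.
    by rewrite in_itv/= => qy; exists q; rewrite ltr_distlC.
  exists ([ffun i => q i], k) => //.
  have yb : box ([ffun i => q i], k) y by move=> i _ /=; rewrite ffunE.
  rewrite /F; case: pselect => //= -[] y' By'; apply: Ar.
  apply: (le_lt_trans (HC _)).
  apply: (@le_lt_trans _ _ (C * ((dim V)%:R * (2 * e)))).
    rewrite ler_wpM2l ?(ltW C0)//.
    apply: (@le_trans _ _ (\sum_(i < dim V) 2 * e)); last first.
      by rewrite sumr_const card_ord -(mulr_natl (2 * e)).
    apply: ler_sum => i _; rewrite pairingB.
    have := By' i I; have := yb i I; rewrite /= => b1 b2.
    rewrite -(subrKA (ratr ([ffun i0 => q i0] i))).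
    apply: (le_trans (ler_normD _ _)).
    rewrite [X in _ + X]distrC mulr2n mulrDl mul1r lerD// ltW//;
      by [apply: lt_trans b2 _|apply: lt_trans b1 _].
  rewrite /e !mulrA ltr_pdivrMr ?ltr_wpDl ?mulr_ge0 ?(ltW C0)//.
  by lra.
apply: countable_bigcupT_measurable => [|qk]; first exact: countableP.
by rewrite /F; case: pselect => /= _; [exact: mbox|exact: measurable0].
Qed.

Lemma dual_normN (y : dual V) : dual_norm (- y) = dual_norm y.
Proof.
have le y' : dual_norm (- y') <= dual_norm y'.
  apply: dual_norm_le => v v1.
  have -> : pairing (- y') v = pairing y' (- v).
    by rewrite pairingNr /pairing opp_lfunE.
  by apply: dual_norm_ub; rewrite normrN.
by apply/eqP; rewrite eq_le le/= -{1}(opprK y) le.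
Qed.

Lemma measurable_dual_norm :
  measurable_fun [set: borel_dual] (fun y : borel_dual => dual_norm (y : dual V)).
Proof.
apply: measurable_gt => a; apply: measurable_dual_open => y /= ay.
exists (dual_norm y - a); first by rewrite subr_gt0.
move=> y'; rewrite -dual_normN opprB => yy'.
have := dual_normD (y - y') y'; rewrite subrK; lra.
Qed.

Lemma measurable_lipschitz_dual (q : dual V -> V) (C : R) : 0 < C ->
  (forall y y', `|q y' - q y| <= C * dual_norm (y' - y)) ->
  measurable_fun [set: borel_dual] (q : borel_dual -> borel V).
Proof.
move=> C0 qC; apply: (@measurability _ _ borel_dual (borel V) setT q open) => //.
move=> _ [A openA <-]; rewrite setTI; apply: measurable_dual_open => y Ay.
have /nbhs_ballP[r /= r0 rA] := open_nbhs_nbhs (conj openA Ay).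
exists (r / C); first by rewrite divr_gt0.
move=> y' yy'; apply: rA; rewrite -ball_normE /ball_/= distrC.
by apply: (le_lt_trans (qC _ _)); rewrite mulrC -ltr_pdivlMr.
Qed.

(** Continuity of the restriction to [D], a form common to [f] and [h] on [X] and to the pairings of
    [gradf] on its domain. *)
Definition dist_continuous_on (D : set V) (g : V -> R) :=
  forall x (e : R), D x -> 0 < e -> exists2 r : R, 0 < r &
    forall z, D z -> `|z - x| < r -> `|g z - g x| < e.

(** Neither [D] nor [g] off [D] is known to be measurable. The superlevel set of the composite is
    nevertheless the preimage under [q] of an open set: the union of the balls on which [g] exceeds
    [a] at all points of [D]. *)
Lemma measurable_comp_on d (T : measurableType d) (D : set V) (g : V -> R)
    (q : T -> V) : dist_continuous_on D g -> (forall t, D (q t)) ->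
  measurable_fun [set: T] (q : T -> borel V) ->
  measurable_fun [set: T] (g \o q).
Proof.
move=> gc Dq mq; apply: measurable_gt => a.
pose I := [set xr : V * R | 0 < xr.2 /\
  forall z, D z -> ball xr.1 xr.2 z -> a < g z].
pose W : set V := \bigcup_(xr in I) ball xr.1 xr.2.
have oW : open W by apply: bigcup_open => xr [r0 _]; exact: ball_open.
have mW : measurable (q @^-1` W).
  rewrite -[X in measurable X]setTI; apply: (mq measurableT).
  exact: sub_sigma_algebra.
rewrite (_ : [set t | _] = q @^-1` W)//.
apply/seteqP; split=> t /= => [agq|[xr [r0 xrI] xrq]]; last exact: xrI.
have [r r0 Hr] : exists2 r : R, 0 < r &
    forall z, D z -> `|z - q t| < r -> `|g z - g (q t)| < g (q t) - a.
  by apply: gc => //; rewrite subr_gt0.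
exists (q t, r); last exact: ballxx.
split=> //= z Dz; rewrite -ball_normE /ball_/= distrC => /(Hr _ Dz).
by rewrite ltr_norml => /andP[]; lra.
Qed.

Lemma within_dist_continuous (D : set V) (g : V -> R) :
  {within D, continuous g} -> dist_continuous_on D g.
Proof.
move=> /subspace_continuousP gc x e Dx e0.
have /cvgrPdist_lt/(_ e e0) := gc x Dx.
rewrite near_withinE => /nbhs_ballP[r /= r0 Hr].
exists r => // z Dz zx; rewrite distrC; apply: Hr => //.
by rewrite -ball_normE /ball_/= distrC.
Qed.

End dual_measurability.

(** * Hitting times *)

Section hitting_time.
Context {R : realType} {V : normedVectType R} {d : measure_display}
  {Omega : measurableType d} {P : probability Omega R}.
Context {x : nat -> Omega -> V} {xs : V} {delta : R}.
Local Open Scope ereal_scope.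

Definition survival (t : nat) : set Omega :=
  \bigcap_(s < t) [set w | (delta < `|x s.+1 w - xs|)%R].

(** [survival t] says that the hitting time exceeds [t], so this is the layer-cake sum; both sides
    are infinite if there is no hit. *)
Lemma hitting_time_sum w :
  hitting_time x xs delta w = \sum_(0 <= t <oo) (\1_(survival t) w)%:E.
Proof.
have ind1 t : w \in survival t -> \1_(survival t) w = 1%R :> R.
  by rewrite indicE => ->.
have [[t0 Ht0]|nhit] := pselect (exists t, (`|x t.+1 w - xs| <= delta)%R).
  have exN : exists t, (`|x t.+1 w - xs| <= delta)%R by exists t0.
  have [N HN minN] := ex_minnP exN.
  have -> : hitting_time x xs delta w = N.+1%:R%:E.
    apply/eqP; rewrite eq_le; apply/andP; split.
      by apply: ereal_inf_lbound; exists N.+1.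
    apply: le_ereal_inf_tmp => _ [[|t] [//= _ Ht] <-].
    by rewrite lee_fin ler_nat ltnS minN.
  rewrite (nneseries_split 0 N.+1)//.
  rewrite eseries0 ?adde0; last first.
    move=> k /= Nk _; rewrite indicE memNset// => /(_ N).
    by rewrite /= ltNge HN => /(_ Nk).
  rewrite add0n big_nat (eq_bigr (fun=> 1%:E)); last first.
    move=> t /andP[_ tN]; rewrite ind1//; apply/mem_set => s /= st.
    rewrite ltNge; apply/negP => /minN; rewrite leqNgt.
    by rewrite (leq_trans st).
  by rewrite -big_nat sumEFin big_const_nat subn0 iter_addr addr0.
have -> : hitting_time x xs delta w = +oo.
  rewrite /hitting_time (_ : [set _ | _ in _] = set0) ?ereal_inf0//.
  apply/seteqP; split=> // _ [[|t] [//= _ Ht] _].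
  by apply: nhit; exists t.
apply/esym/eqyP => A A0.
apply: (@le_trans _ _
  (\sum_(0 <= t < (Num.truncn A).+1) (\1_(survival t) w)%:E)); last first.
  by apply: nneseries_lim_ge => k _; rewrite lee_fin indicE.
rewrite (eq_bigr (fun=> 1%:E)).
  rewrite sumEFin big_const_nat subn0 iter_addr addr0 lee_fin.
  exact/ltW/truncnS_gt.
move=> t _; rewrite ind1//; apply/mem_set => s _ /=.
by rewrite ltNge; apply/negP => sw; apply: nhit; exists s.
Qed.

(** The summand 1 is the bound on the term [survival 0]; the partial sums of the other terms are
    bounded by [B]. *)
Lemma expected_hitting_time (B : R) : (forall t, measurable (survival t)) ->
  (forall n, \sum_(t < n) P (survival t.+1) <= B%:E) ->
  \int[P]_w hitting_time x xs delta w <= (1 + B)%:E.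
Proof.
move=> msurv leB.
under eq_integral do rewrite hitting_time_sum.
have mind t : measurable_fun [set: Omega] (fun w => (\1_(survival t) w : R)%:E).
  by apply/measurable_EFinP; exact: measurable_indic.
rewrite integral_nneseries//.
under eq_eseriesr do rewrite integral_indic// setIT.
apply: lime_le; first by apply: is_cvg_nneseries.
apply: nearW => n.
apply: (@le_trans _ _ (\sum_(0 <= t < n.+1) P (survival t))).
  by rewrite big_nat_recr//= leeDl.
rewrite big_mkord big_ord_recl EFinD leeD//.
exact: probability_le1.
Qed.

End hitting_time.

(** * Integrating out the noise *)

Section noise.
Context {R : realType} {V : normedVectType R} {d : measure_display}
  {Omega : measurableType d} {P : probability Omega R}.
Local Open Scope ereal_scope.

(** The p-th moment bound makes the linear term integrable, so the upper bound on [F] can be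
    integrated term by term and its centred part disappears. *)
Lemma integral_le_unbiased (u : Omega -> dual V) (v : V) (F : Omega -> R)
    (a b k p s : R) :
  (forall v', measurable_fun [set: Omega] (fun w => pairing (u w) v')) ->
  (1 <= p)%R -> (0 <= k)%R ->
  'E_P[(fun w => pairing (u w) v)] = 0 ->
  \int[P]_w ((dual_norm (u w)) `^ p)%:E <= s%:E ->
  measurable_fun [set: Omega] F -> (forall w, 0 <= F w)%R ->
  (forall w, F w <= a + b * pairing (u w) v + k * dual_norm (u w) `^ p)%R ->
  \int[P]_w (F w)%:E <= (a + k * s)%:E.
Proof.
move=> mu p1 k0 Eu0 Nus mF F0 Fle.
have mdu : measurable_fun [set: Omega] (fun w => dual_norm (u w)).
  exact: (measurableT_comp (@measurable_dual_norm R V) (measurable_to_dual mu)).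
pose N w := (dual_norm (u w) `^ p)%R.
have mN : measurable_fun [set: Omega] N.
  exact: (measurableT_comp (measurable_powR p) mdu).
have N0 w : (0 <= N w)%R by exact: powR_ge0.
have iN : P.-integrable [set: Omega] (EFin \o N).
  apply/integrableP; split; first exact/measurable_EFinP.
  under eq_integral do rewrite gee0_abs ?lee_fin//.
  by apply: (le_lt_trans Nus); exact: ltry.
have ic (c : R) : P.-integrable [set: Omega] (EFin \o cst c).
  exact: finite_measure_integrable_cst.
have iu : P.-integrable [set: Omega] (EFin \o (fun w => pairing (u w) v)).
  apply: (@le_integrable _ _ _ _ _ measurableT _
      (EFin \o (fun w => `|v| * (1 + N w))%R)) => //.
  - exact/measurable_EFinP.
  - move=> w _; rewrite /= lee_fin.
    rewrite [leRHS]ger0_norm ?mulr_ge0 ?addr_ge0//.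
    apply: (le_trans (normr_pairing_le _ _)); rewrite mulrC ler_wpM2l//.
    (* The dual norm is at most 1 plus its p-th power, since [p >= 1]. *)
    have [u1|u1] := leP (dual_norm (u w)) 1%R; first by rewrite ler_wpDr.
    by rewrite ler_wpDl// /N le1r_powR// ltW.
  - rewrite (_ : EFin \o _ = (fun w => (`|v|)%:E * (1 + (EFin \o N) w))).
      by apply: integrableZl => //; apply: integrableD => //; exact: (ic 1%R).
    by apply/funext => w /=; rewrite -EFinD -EFinM.
pose G w := (a%:E + b%:E * (pairing (u w) v)%:E) + k%:E * (N w)%:E.
apply: (@le_trans _ _ (\int[P]_w G w)).
  apply: ge0_le_integral => //.
  - by move=> w _; rewrite lee_fin.
  - exact/measurable_EFinP.
  - apply: emeasurable_funD; first apply: emeasurable_funD => //.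
      by apply: emeasurable_funM => //; exact/measurable_EFinP.
    by apply: emeasurable_funM => //; exact/measurable_EFinP.
  - by move=> w _; rewrite /G -!EFinM -!EFinD lee_fin.
have ib : P.-integrable [set: Omega] (fun w => b%:E * (pairing (u w) v)%:E).
  exact: (integrableZl _ _ iu).
have ik : P.-integrable [set: Omega] (fun w => k%:E * (N w)%:E).
  exact: (integrableZl _ _ iN).
rewrite /G integralD//; last by apply: integrableD => //; exact: ic.
rewrite integralD//; last exact: ic.
rewrite !integralZl//.
move: Eu0; rewrite unlock => ->; rewrite mule0 adde0 EFinD EFinM leeD//.
  have -> : \int[P]_w a%:E = a%:E * P [set: Omega] by exact: integral_cst.
  by rewrite probability_setT mule1.
by rewrite lee_wpmul2l ?lee_fin.
Qed.

Lemma dual_norm_scale_le (c : R) (y : dual V) : (0 <= c)%R ->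
  (dual_norm (c *: y) <= c * dual_norm y)%R.
Proof.
move=> c0; apply: dual_norm_le => v v1.
by rewrite pairingZ ler_wpM2l// dual_norm_ub.
Qed.


End noise.

(** * Drift of dual averaging *)

Section sda.
Context {R : realType} {V : normedVectType R} {X : set V}.
Context {h : V -> \bar R} {gradh : V -> dual V} {K : R}.
Context (X_nonempty : X !=set0) (X_compact : compact X)
  (h_convex : convex_efun h) (h_dom : eff_dom h = X)
  (h_continuous : {within X, continuous h})
  (h_selection : continuous_selection h gradh) (K_gt0 : 0 < K)
  (h_strongly_convex : strongly_convex (dom_subdiff h) X h gradh K).
Context {f : V -> \bar R} {gradf : V -> dual V} {mu L p : R} {xs : V}.
Context (f_finite : forall x, X x -> f x \is a fin_num)
  (f_continuous : {within X, continuous f})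
  (f_selection : continuous_selection f gradf)
  (gradf_defined : dom_subdiff h `<=` dom_subdiff f)
  (p_gt1 : 1 < p) (p_le2 : p <= 2)
  (mu_gt0 : 0 < mu)
  (f_strongly_convex : strongly_convex (X `&` dom_subdiff f) X f gradf mu)
  (f_smooth : relatively_smooth X f gradf h gradh L)
  (xs_min : is_minimizer X f xs).
Context {d d' : measure_display} {Omega : measurableType d}
  {P : probability Omega R} {T : measurableType d'}
  {xi : nat -> {RV P >-> T}} {U : V -> T -> dual V} {sigma : R}.
Context (U_measurable : jointly_measurable U)
  (xi_iid : iid (fun t => xi t.+1))
  (U_noise : forall t, (0 < t)%N ->
     unbiased_bounded_noise (dom_subdiff f) U (xi t) sigma p).
Context {eta delta : R} (eta_gt0 : 0 < eta) (eta_le : eta * L <= p^-1).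

Let Q (y : borel_dual) : V := mirror_map X h (eta *: (y : dual V)).
Let in_dom y : dom_subdiff h (Q y) :=
  mirror_map_dom X_nonempty X_compact h_convex h_dom h_continuous _.

Lemma measurable_mirror : measurable_fun [set: borel_dual] (Q : borel_dual -> borel V).
Proof.
apply: (@measurable_lipschitz_dual _ _ _ (eta / K)); first exact: divr_gt0.
move=> y y'; rewrite mulrAC ler_pdivlMr// mulrC.
have := mirror_map_lipschitz X_nonempty X_compact h_convex h_dom h_continuous
  h_selection h_strongly_convex (eta *: y) (eta *: y').
move=> /le_trans; apply; rewrite -scalerBr.
exact/dual_norm_scale_le/ltW.
Qed.

Lemma measurable_comp_mirror (D : set V) (g : V -> R) :
  dist_continuous_on D g -> dom_subdiff h `<=` D ->
  measurable_fun [set: borel_dual] (g \o Q).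
Proof.
move=> gc hD; apply: (measurable_comp_on gc); last exact: measurable_mirror.
by move=> y; exact/hD/in_dom.
Qed.

Lemma dist_continuous_pairing_grad v :
  dist_continuous_on (dom_subdiff f) (fun x => pairing (gradf x) v).
Proof.
move=> x e Dx e0; have k0 : 0 < e / (`|v| + 1) by rewrite divr_gt0// ltr_wpDl.
have [r r0 Hr] := continuous_selection_dist f_selection Dx k0.
exists r => // z Dz zx; rewrite -pairingB.
apply: (le_lt_trans (normr_pairing_le _ _)).
apply: (@le_lt_trans _ _ (e / (`|v| + 1) * `|v|)).
  by rewrite ler_wpM2r// ltW// Hr.
by rewrite mulrAC ltr_pdivrMr ?ltr_wpDl// ltr_pM2l// ltrDl.
Qed.

Lemma dist_continuous_norm : dist_continuous_on setT (fun x : V => `|x - xs|).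
Proof.
move=> x e _ e0; exists e => // z _ zx; apply: le_lt_trans zx.
by apply: (le_trans (ler_dist_dist _ _)); rewrite opprB addrA subrK.
Qed.

Lemma measurable_energy :
  measurable_fun [set: borel_dual] (energy X h f xs eta : borel_dual -> R).
Proof.
have hX : dom_subdiff h `<=` X by exact: dom_subdiff_sub.
have mh := measurable_comp_mirror
  (within_dist_continuous (hr_continuous h_convex h_dom h_continuous)) hX.
have mf := measurable_comp_mirror
  (within_dist_continuous (within_continuous_fine f_finite f_continuous)) hX.
have mc i : measurable_fun [set: borel_dual] ((fun x => v2r (xs - x) 0 i) \o Q).
  apply: (@measurable_comp_mirror setT) => //.
  have [C C0 HC] := @coord_bound R V.
  move=> x e _ e0; exists (e / C) => [|z _ zx]; first exact: divr_gt0.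
  rewrite (_ : _ - _ = v2r (x - z) 0 i); last by rewrite !linearB !mxE; ring.
  apply: (le_lt_trans (HC _ _)); rewrite mulrC -ltr_pdivlMr// distrC//.
(* Both arguments of the pairing vary with [y]; expanding it in coordinates gives a finite sum of
   products of measurable functions. *)
rewrite (_ : energy X h f xs eta = (fun y => fine (h xs) - (fine \o h \o Q) y
   - eta * (\sum_i v2r (xs - Q y) 0 i * pairing y (vbase i))
   + eta * ((fine \o f \o Q) y - fine (f xs)))); last first.
  by apply/funext => y; rewrite /energy pairingZ pairing_sum.
apply: measurable_funD; last first.
  by apply: measurable_funM => //; apply: measurable_funB.
apply: measurable_funB; first exact: measurable_funB.
apply: measurable_funM => //; apply: measurable_sum => i.
by apply: measurable_funM; [exact: mc|exact: measurable_pairing].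
Qed.

(** At a constant rate the dual state alone follows an autonomous recursion driven by the seeds, as
    the drift lemmas require. *)
Let next (z : borel_dual * T) : borel_dual :=
  (z.1 : dual V) - (gradf (Q z.1) + U (Q z.1) z.2).

Lemma measurable_next : measurable_fun [set: borel_dual * T] next.
Proof.
apply: measurable_to_dual => v.
rewrite (_ : (fun t => _) = (fun z => pairing z.1 v
    - (pairing (gradf (Q z.1)) v + pairing (U (Q z.1) z.2) v))); last first.
  by apply/funext => z; rewrite pairingB pairingD.
apply: measurable_funB.
  exact: (measurableT_comp (@measurable_pairing R V v) measurable_fst).
apply: measurable_funD.
  exact: (measurableT_comp (measurable_comp_mirror
    (dist_continuous_pairing_grad v) gradf_defined) measurable_fst).
have mQ : measurable_fun [set: borel_dual * T]
    (fun z => (Q z.1, z.2) : borel V * T).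
  apply: measurable_fun_pair => //.
  exact: (measurableT_comp measurable_mirror measurable_fst).
exact: (measurableT_comp (U_measurable v) mQ).
Qed.

Let delta_eta2 := 2 / (mu * p) * eta `^ (p - 1)
  * (diam X `^ (2 - p) * (2 / K) `^ (p - 1) * sigma `^ p).
Let c := eta * (mu / 2) * (delta ^+ 2 - delta_eta2).
Context (delta_gt0 : 0 < delta) (delta_eta : delta_eta2 < delta ^+ 2).

Let c_gt0 : 0 < c.
Proof. by rewrite !mulr_gt0 ?subr_gt0// invr_gt0. Qed.

Lemma energy_drift t (y : borel_dual) : delta < `|Q y - xs| ->
  (\int[P]_w (energy X h f xs eta
     (next (y, xi t.+1 w)) + c)%:E
   <= (energy X h f xs eta y)%:E)%E.
Proof.
move=> ybad.
have p0 : 0 < p := lt_trans ltr01 p_gt1.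
have [unb bnd] := U_noise (ltn0Sn t) (gradf_defined (in_dom y)).
pose k := p^-1 * (diam X `^ (2 - p) * (2 / K) `^ (p - 1) * eta `^ p).
have k0 : 0 <= k by rewrite !mulr_ge0 ?powR_ge0// invr_ge0 ltW.
have etaE : eta `^ p = eta * eta `^ (p - 1) by rewrite mulr_powRB1// ltW.
(* [delta_eta2] is defined by this balance: the drift [c] plus the noise cost of a step equals the
   gain from strong convexity at distance [delta]. *)
have cE : c + k * sigma `^ p = eta * (mu / 2) * delta ^+ 2.
  rewrite /c /delta_eta2 /k etaE; field.
  by rewrite !gt_eqF.
have mU v : measurable_fun [set: Omega]
    (fun w => pairing (U (Q y) (xi t.+1 w)) v).
  have mpair : measurable_fun [set: Omega]
      (fun w => (Q y, xi t.+1 w) : borel V * T).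
    by apply: measurable_fun_pair => //; exact: measurable_cst.
  exact: (measurableT_comp (U_measurable v) mpair).
have mF : measurable_fun [set: Omega] (fun w =>
    energy X h f xs eta (next (y, xi t.+1 w)) + c).
  apply: measurable_funD => //.
  have mpair : measurable_fun [set: Omega]
      (fun w => (y, xi t.+1 w) : borel_dual * T).
    by apply: measurable_fun_pair => //; exact: measurable_cst.
  exact: (measurableT_comp measurable_energy (measurableT_comp measurable_next mpair)).
have F0 w : 0 <= energy X h f xs eta (next (y, xi t.+1 w)) + c.
  rewrite addr_ge0 ?(ltW c_gt0)//.
  exact: (energy_ge0 X_nonempty X_compact h_convex h_dom h_continuous
    h_selection K_gt0 h_strongly_convex f_finite xs_min _ (ltW eta_gt0)).
have aE : energy X h f xs eta y
    - eta * (mu / 2) * delta ^+ 2 + c + k * sigma `^ p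
    = energy X h f xs eta y by rewrite -addrA cE subrK.
have := @integral_le_unbiased _ _ _ _ P (fun w => U (Q y) (xi t.+1 w)) (xs - Q y)
  _ (energy X h f xs eta y - eta * (mu / 2) * delta ^+ 2 + c)
  eta k p (sigma `^ p) mU (ltW p_gt1) k0 (unb _) bnd mF F0.
rewrite aE; apply => w.
have := energy_descent X_nonempty X_compact h_convex h_dom h_continuous
    h_selection K_gt0 h_strongly_convex f_finite gradf_defined p_gt1 p_le2
    f_strongly_convex f_smooth xs_min (U (Q y) (xi t.+1 w)) eta_gt0 eta_le
    (erefl (Q y)).
have : eta * (mu / 2) * delta ^+ 2 <= eta * (mu / 2) * `|Q y - xs| ^+ 2.
  apply: ler_wpM2l; first by rewrite mulr_ge0 ?divr_ge0// ltW.
  by apply: lerXn2r; rewrite ?nnegrE// ltW.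
rewrite /next /k/=; lra.
Qed.

Lemma sda_hitting_time (y : nat -> Omega -> dual V) (x : nat -> Omega -> V) :
  SDA X gradf h U xi (fun=> eta) 0 y x ->
  (\int[P]_w hitting_time x xs delta w <=
   (1 + energy X h f xs eta 0 / c)%:E)%E.
Proof.
move=> sda.
pose bad : set borel_dual := [set y | delta < `|Q y - xs|].
have mbad : measurable bad.
  have mn := measurable_comp_mirror dist_continuous_norm (@subsetT _ _).
  have := mn measurableT `]delta, +oo[%classic (measurable_itv _).
  rewrite setTI (_ : _ @^-1` _ = bad)//.
  by apply/seteqP; split=> z; rewrite /bad /= in_itv/= andbT.
(* States are counted from 0 and iterates from 1: [state s] yields the iterate [s.+1] and is updated
   with seed [s.+1]. *)
pose state t w : borel_dual := y t.+1 w.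
have state0 w : state 0 w = 0 by have [] := sda w.
have stateS t w : state t.+1 w = next (state t w, xi t.+1 w).
  by have [_ /(_ t.+1 isT)[xE yE]] := sda w; rewrite /state yE xE.
have xE s w : x s.+1 w = Q (state s w).
  by have [_ /(_ s.+1 isT)[]] := sda w.
have survE t : survival (x := x) (xs := xs) (delta := delta) t =
    stay (state := state) (bad := bad) t.
  apply: eq_bigcapr => s _; apply/funext => w.
  by rewrite /preimage /mkset /bad /= xE.
have E0 z : 0 <= energy X h f xs eta z.
  exact: (energy_ge0 X_nonempty X_compact h_convex h_dom h_continuous
    h_selection K_gt0 h_strongly_convex f_finite xs_min _ (ltW eta_gt0)).
apply: expected_hitting_time.
  move=> t; rewrite survE.
  exact: (stay_measurableT measurable_next state0 stateS mbad).
move=> n; under eq_bigr do rewrite survE.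
rewrite mulrC EFinM lee_pdivlMl//.
exact: (drift_sum xi_iid measurable_next state0 stateS mbad measurable_energy
  E0 (ltW c_gt0) energy_drift).
Qed.

End sda.

(** * Constants and rates *)

Section final_bounds.
Context {R : realType}.
Implicit Types mu eta gap H E A D delta p v : R.

(** The summand 1 is at most [delta ^+ 2 / (delta ^+ 2 - d2)], which is the origin of the term
    [mu * delta ^+ 2 / 2] in the numerator. *)
Lemma hitting_bound_le mu eta gap H E delta (d2 : R) : 0 < mu -> 0 < eta -> 0 <= d2 ->
  d2 < delta ^+ 2 -> E <= H + eta * gap ->
  1 + E / (eta * (mu / 2) * (delta ^+ 2 - d2)) <=
  2 / mu * ((H / eta + gap + mu * delta ^+ 2 / 2) / (delta ^+ 2 - d2)).
Proof.
move=> mu0 eta0 d20 d2lt EH; set D := delta ^+ 2 - d2.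
have D0 : 0 < D by rewrite subr_gt0.
have le1 : 1 <= delta ^+ 2 / D by rewrite ler_pdivlMr// mul1r lerBlDr lerDl.
have le2 : E / (eta * (mu / 2) * D) <= (H + eta * gap) / (eta * (mu / 2) * D).
  by rewrite ler_wpM2r// invr_ge0 !mulr_ge0 ?invr_ge0// ltW.
apply: (le_trans (lerD le1 le2)); rewrite le_eqVlt; apply/orP; left; apply/eqP.
by field; rewrite !gt_eqF.
Qed.

Lemma powRV (a s : R) : 0 <= a -> a^-1 `^ s = (a `^ s)^-1.
Proof. by move=> a0; rewrite -powR_inv1// -powRrM mulN1r powRN. Qed.

Lemma powR_rate A v p : 0 < A -> 0 < v -> 1 < p ->
  (A * (A / v `^ p) `^ (p - 1)^-1)^-1 = (v / A) `^ (p / (p - 1)).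
Proof.
move=> A0 v0 p1; have p10 : 0 < p - 1 by rewrite subr_gt0.
have vp0 : 0 < v `^ p by exact: powR_gt0.
have Ap0 : 0 < A `^ (p - 1) by exact: powR_gt0.
have -> : (v / A) `^ (p / (p - 1)) = ((A / v `^ p)^-1 / A `^ (p - 1)) `^ (p - 1)^-1.
  rewrite powRrM powRM ?invr_ge0 ?(ltW v0) ?(ltW A0)// powRV ?(ltW A0)//.
  rewrite -(mulr_powRB1 (ltW A0) (lt_trans ltr01 p1)).
  by congr (_ `^ _); rewrite invf_div invfM mulrA.
have B0 : 0 < A / v `^ p by rewrite divr_gt0.
rewrite [RHS]powRM ?invr_ge0 ?ltW// !powRV ?ltW// -powRrM mulfV ?gt_eqF//.
by rewrite powRr1 ?ltW// invfM mulrC.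
Qed.

(** For this rate the noise floor is exactly [delta ^+ 2 / p], so the denominator is
    [delta ^+ 2 * (p - 1) / p]; the power in the last term comes from [powR_rate] with
    [A = mu * delta ^+ 2 / 2]. *)
Lemma hitting_bound_eq mu eta gap H v p delta : 0 < mu -> 0 < v -> 1 < p ->
  0 < delta ->
  eta = (mu * delta ^+ 2 / (2 * v `^ p)) `^ (p - 1)^-1 ->
  2 / mu * ((H / eta + gap + mu * delta ^+ 2 / 2)
            / (delta ^+ 2 - 2 / (mu * p) * eta `^ (p - 1) * v `^ p)) =
  p / (p - 1) * (1 + 2 * gap / (mu * delta ^+ 2)
                 + H * (2 * v / (mu * delta ^+ 2)) `^ (p / (p - 1))).
Proof.
move=> mu0 v0 p1 delta0 etaE.
have p10 : 0 < p - 1 by rewrite subr_gt0.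
have p0 : 0 < p by exact: lt_trans p1.
have vp0 : 0 < v `^ p by exact: powR_gt0.
pose A := mu * delta ^+ 2 / 2.
have A0 : 0 < A by rewrite divr_gt0// mulr_gt0// exprn_gt0.
have B0 : 0 < A / v `^ p by rewrite divr_gt0.
have BE : mu * delta ^+ 2 / (2 * v `^ p) = A / v `^ p by rewrite invfM mulrA.
rewrite BE in etaE.
have eta0 : 0 < eta by rewrite etaE powR_gt0.
have -> : 2 * v / (mu * delta ^+ 2) = v / A.
  by rewrite /A; field; rewrite !gt_eqF.
rewrite -powR_rate// -etaE.
have -> : eta `^ (p - 1) = A / v `^ p.
  by rewrite etaE -powRrM mulVf ?gt_eqF// powRr1// ltW.
rewrite /A; field.
have dp : delta ^+ 2 * p - delta ^+ 2 != 0.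
  by rewrite -{2}[delta ^+ 2]mulr1 -mulrBr mulf_neq0 ?expf_neq0 ?gt_eqF.
by rewrite dp !gt_eqF.
Qed.

Lemma sqr_powR (a s : R) : 0 <= a -> (a ^+ 2) `^ s = a `^ (2 * s).
Proof. by move=> a0; rewrite powRrM powR_mulrn. Qed.

(** The term in [H] has exactly the claimed order. The other two are of lower or equal order for
    [delta < 1], because [p / (p - 1) >= 1]. *)
Lemma bound_bigO mu gap H v p : 0 < mu -> 0 <= v -> 0 <= H -> 0 <= gap -> 1 < p ->
  (fun delta : R => p / (p - 1) * (1 + 2 * gap / (mu * delta ^+ 2)
                 + H * (2 * v / (mu * delta ^+ 2)) `^ (p / (p - 1))))
  =O_ (at_right 0) (fun delta => 1 / delta `^ (2 * p / (p - 1))).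
Proof.
move=> mu0 v0 H0 gap0 p1.
have p10 : 0 < p - 1 by rewrite subr_gt0.
have p0 : 0 < p by exact: lt_trans p1.
set q := p / (p - 1).
have q0 : 0 < q by rewrite divr_gt0.
have q1 : 1 <= q by rewrite ler_pdivlMr// mul1r gerBl.
pose C := q * (1 + 2 * gap / mu + H * (2 * v / mu) `^ q).
apply/eqOP; near=> k; near=> delta.
have d0 : 0 < delta by near: delta; exact: nbhs_right_gt.
have d1 : delta < 1 by near: delta; exact: nbhs_right_lt.
have -> : 2 * p / (p - 1) = 2 * q by rewrite mulrA.
have r0 : 0 < delta `^ (2 * q) by exact: powR_gt0.
have rle : delta `^ (2 * q) <= delta ^+ 2.
  rewrite -powR_mulrn ?(ltW d0)//; apply: ger_powR; first by rewrite d0 ltW.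
  by rewrite ler_peMr.
have t0 : 0 <= (2 * v / mu) `^ q by exact: powR_ge0.
have term3 : (2 * v / (mu * delta ^+ 2)) `^ q = (2 * v / mu) `^ q / delta `^ (2 * q).
  rewrite invfM mulrA powRM ?invr_ge0 ?sqr_ge0 ?divr_ge0 ?mulr_ge0 ?(ltW mu0)//.
  by rewrite powRV ?sqr_ge0// sqr_powR// ltW.
have term1 : 1 <= (delta `^ (2 * q))^-1.
  rewrite invf_ge1//; apply: (le_trans rle); rewrite expr_le1 ?ltW//.
have term2 : 2 * gap / (mu * delta ^+ 2) <= 2 * gap / mu / delta `^ (2 * q).
  rewrite invfM mulrA ler_wpM2l ?divr_ge0 ?mulr_ge0 ?(ltW mu0)//.
  by rewrite lef_pV2 ?posrE ?exprn_gt0.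
rewrite term3 mul1r [X in _ <= _ * X]ger0_norm ?invr_ge0 ?(ltW r0)//.
rewrite ger0_norm; last first.
  rewrite mulr_ge0 ?(ltW q0)// !addr_ge0// ?mulr_ge0 ?invr_ge0 ?mulr_ge0
    ?sqr_ge0//; exact: ltW.
apply: (@le_trans _ _ (C * (delta `^ (2 * q))^-1)); last first.
  rewrite ler_wpM2r ?invr_ge0 ?(ltW r0)//; near: k; exact: nbhs_pinfty_ge.
rewrite /C -[leRHS]mulrA ler_wpM2l ?(ltW q0)//.
set t := _ `^ q in t0 term3 *; set r := delta `^ (2 * q) in r0 rle term1 term2 *.
have -> : (1 + 2 * gap / mu + H * t) * r^-1
    = r^-1 + 2 * gap / mu / r + H * (t / r) by ring.
by rewrite !lerD.
Unshelve. all: by end_near. Qed.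

End final_bounds.

(** * Extrema over the compact set *)

Section extrema.
Context {R : realType} {V : normedVectType R} {X : set V}.
Context (X_nonempty : X !=set0) (X_compact : compact X).

(** The supremum is attained, hence finite, so that [fine] does not replace it by 0. *)
Lemma le_max_on (g : V -> \bar R) x : (forall x, X x -> g x \is a fin_num) ->
  {within X, continuous g} -> X x -> fine (g x) <= max_on X g.
Proof.
move=> gfin gc Xx.
have [c /set_mem Xc cm] := compact_EVT_max X_nonempty X_compact
  (within_continuous_fine gfin gc).
apply: (le_trans (cm x (mem_set Xx))); rewrite /max_on (_ : ereal_sup _ = g c)//.
apply/eqP; rewrite eq_le; apply/andP; split; last by apply: ereal_sup_ubound; exists c.
apply: ge_ereal_sup => _ [z Xz <-].
by rewrite -(fineK (gfin _ Xz)) -(fineK (gfin _ Xc)) lee_fin; exact/cm/mem_set.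
Qed.

Lemma min_on_minimizer (g : V -> \bar R) c : is_minimizer X g c ->
  min_on X g = fine (g c).
Proof.
move=> [Xc cm]; rewrite /min_on (_ : ereal_inf _ = g c)//.
apply/eqP; rewrite eq_le; apply/andP; split; first by apply: ereal_inf_lbound; exists c.
by apply: le_ereal_inf_tmp => _ [z Xz <-]; exact: cm.
Qed.

Lemma min_on_le (g : V -> \bar R) x : (forall x, X x -> g x \is a fin_num) ->
  {within X, continuous g} -> X x -> min_on X g <= fine (g x).
Proof.
move=> gfin gc Xx.
have [c /set_mem Xc cm] := compact_EVT_min X_nonempty X_compact
  (within_continuous_fine gfin gc).
rewrite (@min_on_minimizer g c); first exact/cm/mem_set.
split=> // z Xz.
by rewrite -(fineK (gfin _ Xz)) -(fineK (gfin _ Xc)) lee_fin; exact/cm/mem_set.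
Qed.

End extrema.

(** For the degenerate case of a one-point [X], where the first iterate is already the minimizer. *)
Lemma hitting_time_le1 (R : realType) (V : normedVectType R)
    (d : measure_display) (Omega : measurableType d) (P : probability Omega R)
    (x : nat -> Omega -> V) (xs : V) (delta : R) :
  (forall w, `|x 1%N w - xs| <= delta) ->
  (\int[P]_w hitting_time x xs delta w <= 1%:E)%E.
Proof.
move=> hit; rewrite -[X in X%:E]addr0.
have surv0 t : survival (x := x) (xs := xs) (delta := delta) t.+1 = set0.
  apply/seteqP; split=> // w /(_ 0%N isT) /=.
  by rewrite ltNge hit.
apply: expected_hitting_time => [[|t]|n].
- by rewrite (_ : survival 0 = setT)//; apply/seteqP; split.
- by rewrite surv0.
- by rewrite big1// => t _; rewrite surv0 measure0.
Qed.

Theorem theorem8 (R : realType) (V : normedVectType R) (X : set V)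
  (f : V -> \bar R) (gradf : V -> dual V) (mu L : R)
  (h : V -> \bar R) (gradh : V -> dual V) (K : R)
  (d : measure_display) (Omega : measurableType d) (P : probability Omega R)
  (d' : measure_display) (T : measurableType d')
  (xi : nat -> {RV P >-> T}) (U : V -> T -> dual V) (sigma p : R) (xs : V)
  (X_nonempty : X !=set0) (X_compact : compact X) (X_convex : convex_set X)
  (f_convex : convex_efun f)
  (f_finite : forall x, X x -> f x \is a fin_num)
  (f_continuous : {within X, continuous f})
  (f_selection : continuous_selection f gradf)
  (h_convex : convex_efun h) (h_dom : eff_dom h = X)
  (h_continuous : {within X, continuous h})
  (h_selection : continuous_selection h gradh)
  (K_gt0 : 0 < K)
  (h_strongly_convex : strongly_convex (dom_subdiff h) X h gradh K)
  (gradf_defined : dom_subdiff h `<=` dom_subdiff f)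
  (p_gt1 : 1 < p) (p_le2 : p <= 2) (sigma_gt0 : 0 < sigma)
  (U_measurable : jointly_measurable U)
  (xi_iid : iid (fun t => xi t.+1))
  (U_noise : forall t, (0 < t)%N ->
     unbiased_bounded_noise (dom_subdiff f) U (xi t) sigma p)
  (mu_gt0 : 0 < mu)
  (f_strongly_convex : strongly_convex (X `&` dom_subdiff f) X f gradf mu)
  (f_smooth : relatively_smooth X f gradf h gradh L)
  (xs_min : is_minimizer X f xs) :
  let Vs := noise_const X K sigma p in
  let H := max_on X h - min_on X h in
  let x1 := mirror_map X h 0 in
  let gap := fine (f x1) - min_on X f in
  let bound (delta : R) : R :=
    p / (p - 1) * (1 + 2 * gap / (mu * delta ^+ 2)
                   + H * (2 * Vs / (mu * delta ^+ 2)) `^ (p / (p - 1))) in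
  (exists2 delta0 : R, 0 < delta0 &
    forall delta : R, 0 < delta <= delta0 ->
      (forall (eta : R) (y : nat -> Omega -> dual V) (x : nat -> Omega -> V),
         0 < eta ->
         (* if Vs = 0, i.e. X is a point and p < 2, the upper bound is +oo *)
         (0 < Vs ->
          eta < (mu * p * delta ^+ 2 / (2 * Vs `^ p)) `^ (p - 1)^-1) ->
         SDA X gradf h U xi (fun=> eta) 0 y x ->
         let delta_eta2 := 2 / (mu * p) * eta `^ (p - 1) * Vs `^ p in
         (\int[P]_w hitting_time x xs delta w <=
           (2 / mu * ((H / eta + gap + mu * delta ^+ 2 / 2)
                      / (delta ^+ 2 - delta_eta2)))%:E)%E) /\
      (forall (y : nat -> Omega -> dual V) (x : nat -> Omega -> V),
         let eta := (mu * delta ^+ 2 / (2 * Vs `^ p)) `^ (p - 1)^-1 in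
         SDA X gradf h U xi (fun=> eta) 0 y x ->
         (\int[P]_w hitting_time x xs delta w <= (bound delta)%:E)%E)) /\
  bound =O_ (at_right 0) (fun delta => 1 / delta `^ (2 * p / (p - 1))).
Proof.
move=> Vs H x1 gap bound.
have p0 : 0 < p := lt_trans ltr01 p_gt1.
have p10 : 0 < p - 1 by rewrite subr_gt0.
pose W := diam X `^ (2 - p) * (2 / K) `^ (p - 1) * sigma `^ p.
have W0 : 0 <= W by rewrite !mulr_ge0// powR_ge0.
have Vs0 : 0 <= Vs by exact: powR_ge0.
have VsW : Vs `^ p = W by rewrite /Vs /noise_const -/W -powRrM mulVf ?gt_eqF// powRr1.
have inX y := @mirror_map_in _ _ _ _ X_nonempty X_compact h_convex h_dom h_continuous y.
have h_finite x : X x -> h x \is a fin_num by move=> Xx; rewrite (h_fin h_convex h_dom).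
have Xx1 : X x1 by exact: inX.
have gapE : gap = fine (f x1) - fine (f xs) by rewrite /gap (min_on_minimizer xs_min).
have gap0 : 0 <= gap by rewrite gapE subr_ge0; exact: (fr_min f_finite xs_min).
have h_le x : X x -> fine (h x) <= max_on X h by exact: le_max_on.
have h_ge x : X x -> min_on X h <= fine (h x) by exact: min_on_le.
have H0 : 0 <= H.
  by rewrite subr_ge0; exact: le_trans (h_ge _ Xx1) (h_le _ Xx1).
have energy0 eta : energy X h f xs eta 0 <= H + eta * gap.
  rewrite /energy scaler0 -/x1 gapE lerD2r /pairing zero_lfunE subr0.
  by rewrite lerB ?h_le ?h_ge//; exact: xs_min.1.
have q0 : 0 < (p - 1)^-1 by rewrite invr_gt0.
(* As [K] and [sigma] are positive, [Vs = 0] forces [diam X = 0], so every point of [X] is [xs],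
   whatever the rate. *)
have singleton (eta : nat -> R) y x delta : Vs = 0 -> 0 < delta ->
    SDA X gradf h U xi eta 0 y x ->
    (\int[P]_w hitting_time x xs delta w <= 1%:E)%E.
  move=> V0 d0 sda; apply: hitting_time_le1 => w.
  have [_ /(_ 1%N isT)[-> _]] := sda w.
  apply: (le_trans (diam_ub X_compact xs_min.1 (inX _))).
  have : W == 0 by rewrite -VsW V0 powR0// gt_eqF.
  rewrite /W !mulf_eq0 !powR_eq0 (gt_eqF sigma_gt0) orbF.
  rewrite (_ : (2 / K == 0) = false) ?orbF; last by rewrite gt_eqF// divr_gt0.
  by move=> /andP[/eqP -> _]; exact: ltW.
have part1 delta eta y x : 0 < delta -> 0 < eta -> eta * L <= p^-1 ->
    (0 < Vs -> eta < (mu * p * delta ^+ 2 / (2 * Vs `^ p)) `^ (p - 1)^-1) ->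
    SDA X gradf h U xi (fun=> eta) 0 y x ->
    (\int[P]_w hitting_time x xs delta w <=
      (2 / mu * ((H / eta + gap + mu * delta ^+ 2 / 2)
        / (delta ^+ 2 - 2 / (mu * p) * eta `^ (p - 1) * Vs `^ p)))%:E)%E.
  move=> d0 eta0 etaL eta_lt sda.
  have d20 : 0 <= 2 / (mu * p) * eta `^ (p - 1) * W.
    by rewrite !mulr_ge0 ?powR_ge0// invr_ge0 mulr_ge0// ltW.
  have d2lt : 2 / (mu * p) * eta `^ (p - 1) * W < delta ^+ 2.
    have [V0|V0] := leP Vs 0.
      have V00 : Vs = 0 by apply: le_anti; rewrite V0 Vs0.
      have -> : W = 0 by rewrite -VsW V00 powR0// gt_eqF.
      by rewrite mulr0 exprn_gt0.
    have Wgt0 : 0 < W by rewrite -VsW powR_gt0.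
    have /eta_lt := V0; rewrite VsW => lt1.
    have W20 : 0 < 2 * W by exact: mulr_gt0.
    have B0 : 0 < mu * p * delta ^+ 2 / (2 * W).
      by apply: divr_gt0; rewrite mulr_gt0// ?exprn_gt0// mulr_gt0.
    have := gt0_ltr_powR p10 _ _ lt1.
    rewrite !nnegrE (ltW eta0) powR_ge0 => /(_ isT isT).
    rewrite -powRrM mulVf ?gt_eqF// powRr1 ?(ltW B0)// ltr_pdivlMr// => lt2.
    have -> : 2 / (mu * p) * eta `^ (p - 1) * W = eta `^ (p - 1) * (2 * W) / (mu * p).
      by ring.
    by rewrite ltr_pdivrMr ?mulr_gt0// [delta ^+ 2 * _]mulrC.
  rewrite VsW; apply: le_trans (sda_hitting_time X_nonempty X_compact h_convex
    h_dom h_continuous h_selection K_gt0 h_strongly_convex f_finite f_continuous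
    f_selection gradf_defined p_gt1 p_le2 mu_gt0 f_strongly_convex f_smooth
    xs_min U_measurable xi_iid U_noise eta0 etaL d0 d2lt sda) _.
  by rewrite lee_fin; exact: hitting_bound_le.
split; last exact: bound_bigO.
(* A positive bound on the rates that also serves for [L <= 0]. *)
pose M := (p * (`|L| + 1))^-1.
have M0 : 0 < M by rewrite invr_gt0 mulr_gt0// ltr_wpDl.
have ML eta : 0 < eta -> eta <= M -> eta * L <= p^-1.
  move=> eta0 etaM; apply: (@le_trans _ _ (M * `|L|)).
    apply: (@le_trans _ _ (eta * `|L|)); first by rewrite ler_wpM2l ?ler_norm// ltW.
    by rewrite ler_wpM2r.
  rewrite /M invfM -mulrA ler_piMr ?invr_ge0 ?(ltW p0)//.
  by rewrite mulrC ler_pdivrMr ?ltr_wpDl// mul1r lerDl.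
have [V0|Vgt0] := leP Vs 0.
  have Vs00 : Vs = 0 by apply: le_anti; rewrite V0 Vs0.
  exists 1 => // delta /andP[d0 _]; split=> [eta y x eta0 _ sda|y x eta sda].
    cbv zeta; apply: (le_trans (singleton _ _ _ _ Vs00 d0 sda)); rewrite lee_fin.
    rewrite Vs00 powR0 ?gt_eqF// mulr0.
    (* The right-hand side is at least 1: take zero energy and no noise floor. *)
    apply: le_trans (hitting_bound_le (E := 0) mu_gt0 eta0 (lexx 0) _ _).
    - by rewrite mul0r addr0.
    - by rewrite exprn_gt0.
    - by rewrite addr_ge0// mulr_ge0// ltW.
  (* Here [eta] is 0, through division by zero; the bound is still at least 1 because
     [p / (p - 1) >= 1]. *)
  apply: (le_trans (singleton _ _ _ _ Vs00 d0 sda)); rewrite lee_fin /bound.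
  have q1 : 1 <= p / (p - 1) by rewrite ler_pdivlMr// mul1r gerBl.
  rewrite -[leLHS]mulr1 ler_pM//.
  rewrite -addrA lerDl addr_ge0//; last by rewrite mulr_ge0// powR_ge0.
  by rewrite divr_ge0 ?mulr_ge0 ?sqr_ge0// ltW.
have Wgt0 : 0 < W by rewrite -VsW powR_gt0.
(* [D] is the value of [delta ^+ 2] at which the upper limit on the rate equals [M]; below it every
   admissible rate is at most [M]. *)
pose D := 2 * W * M `^ (p - 1) / (mu * p).
have W20 : 0 < 2 * W by exact: mulr_gt0.
have D0 : 0 < D.
  apply: divr_gt0; last exact: mulr_gt0.
  by apply: mulr_gt0 => //; exact: powR_gt0.
exists (Num.sqrt D); first by rewrite sqrtr_gt0.
move=> delta /andP[d0 dD].
have etaM (eta : R) :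
    eta < (mu * p * delta ^+ 2 / (2 * Vs `^ p)) `^ (p - 1)^-1 -> eta <= M.
  move=> /ltW /le_trans; apply.
  have -> : M = (M `^ (p - 1)) `^ (p - 1)^-1.
    by rewrite -powRrM mulfV ?gt_eqF// powRr1// ltW.
  apply: ge0_ler_powR; rewrite ?nnegrE ?powR_ge0 ?(ltW q0)//.
    by rewrite divr_ge0 ?mulr_ge0 ?sqr_ge0 ?powR_ge0// ltW.
  rewrite VsW ler_pdivrMr//.
  have : delta ^+ 2 <= D.
    rewrite -(sqr_sqrtr (ltW D0)); apply: lerXn2r; rewrite ?nnegrE ?sqrtr_ge0//.
    exact: ltW.
  by rewrite /D ler_pdivlMr ?mulr_gt0//; lra.
split=> [eta y x eta0 eta_lt sda|y x eta sda].
  have {}eta_lt := eta_lt isT; cbv zeta.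
  exact: (part1 _ _ _ _ d0 eta0 (ML _ eta0 (etaM _ eta_lt)) (fun=> eta_lt) sda).
have Vp0 : 0 < Vs `^ p by rewrite powR_gt0.
have eta0 : 0 < eta by rewrite powR_gt0// divr_gt0 ?mulr_gt0 ?exprn_gt0.
(* The two expressions differ by the factor [p > 1] inside the power. *)
have eta_lt : eta < (mu * p * delta ^+ 2 / (2 * Vs `^ p)) `^ (p - 1)^-1.
  apply: gt0_ltr_powR; rewrite ?nnegrE//.
  - by rewrite divr_ge0 ?mulr_ge0 ?sqr_ge0// ltW.
  - by rewrite divr_ge0 ?mulr_ge0 ?sqr_ge0// ltW.
  rewrite ltr_pM2r ?invr_gt0 ?mulr_gt0// ltr_pM2r ?exprn_gt0//.
  by rewrite ltr_pMr.
have -> : bound delta = 2 / mu * ((H / eta + gap + mu * delta ^+ 2 / 2)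
    / (delta ^+ 2 - 2 / (mu * p) * eta `^ (p - 1) * Vs `^ p)).
  by rewrite /bound -(hitting_bound_eq (eta := eta)).
exact: (part1 _ _ _ _ d0 eta0 (ML _ eta0 (etaM _ eta_lt)) (fun=> eta_lt) sda).
Qed.
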